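(* In the extra-special case, the posets $(\mathrm{AN}(\Delta(1)),\le_{up})$ and $((\Delta_l)^\vee/\!\sim,\le)$ are naturally isomorphic; explicitly, the map sending $\Gamma\in\mathrm{AN}(\Delta(1))$ to the class of $w(\theta^\vee)$, for any $w\in W^0$ with $\min(\Delta(1)\setminus N(w))=\Gamma$, is a well-defined isomorphism.
   Context: Let $\mathfrak g$ be a complex simple Lie algebra with root system $\Delta$ in a real Euclidean space with $W$-invariant inner product $(\,,\,)$, positive roots $\Delta^+$, simple roots $\Pi$, Weyl group $W$, highest root $\theta$. For $\gamma\in\Delta$, $\gamma^\vee=2\gamma/(\gamma,\gamma)$; $\Pi^\vee=\{\alpha^\vee:\alpha\in\Pi\}$. Let $\Delta_l$ (resp. $\Delta_l^+$, $\Pi_l$) be the set of roots (resp. positive roots, simple roots) of the same length as $\theta$, and $(\Delta_l)^\vee=\{\gamma^\vee:\gamma\in\Delta_l\}$, ordered by $\nu\preccurlyeq\mu$ iff $\mu-\nu$ is a nonnegative integer combination of $\Pi^\vee$. Let $P_+=\{\gamma^\vee:\gamma\in\Delta_l^+\}$ and $P_-=-P_+$. $(\Delta_l)^\vee/\!\sim$ is obtained from $(\Delta_l)^\vee$ by identifying $\alpha^\vee$ with $-\alpha^\vee$ for each $\alpha\in\Pi_l$, with the partial order: for classes $x,y$, $x\le y$ iff either they have representatives in $P_+$ with $x\preccurlyeq y$, or representatives in $P_-$ with $x\preccurlyeq y$, or $x$ has a representative $x'\in P_-$ and $y$ a representative $y'\in P_+$ such that $x'\preccurlyeq-\alpha^\vee$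 and $\alpha^\vee\preccurlyeq y'$ for some $\alpha\in\Pi_l$ (i.e. the orders on $P_+$ and $P_-$ are kept and the two parts are glued along $\min P_+=\{\alpha^\vee:\alpha\in\Pi_l\}$ and $\max P_-=\{-\alpha^\vee:\alpha\in\Pi_l\}$). Extra-special case: $\Delta(j)=\{\gamma\in\Delta:(\gamma,\theta^\vee)=j\}$, $\Delta(0)^+=\Delta(0)\cap\Delta^+$, $\Pi(0)=\Pi\cap\Delta(0)$; $\Delta(1)$ is partially ordered by $\mu\preccurlyeq\gamma$ iff $\gamma-\mu$ is a nonnegative integer combination of $\Pi(0)$. $W^0=\{w\in W:w(\alpha)\in\Delta^+\ \forall\alpha\in\Delta(0)^+\}$, $N(w)=\{\gamma\in\Delta^+:w(\gamma)\in-\Delta^+\}$. $\mathrm{AN}(\Delta(1))$ is the set of antichains of $\Delta(1)$, ordered by $\Gamma\le_{up}\Gamma'$ iff $I(\Gamma)\subset I(\Gamma')$, where $I(\Gamma)$ is the upper ideal generated by $\Gamma$. *)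

(* Defs.v *)
From HB Require Import structures.
From mathcomp Require Import all_boot all_order all_algebra finmap.
From mathcomp Require Import sesquilinear.
From mathcomp Require Import boolp classical_sets functions reals.

Set Implicit Arguments.
Unset Strict Implicit.
Unset Printing Implicit Defensive.

Import Order.TTheory GRing.Theory Num.Theory.
Local Open Scope ring_scope.
Local Open Scope fset_scope.
Local Open Scope classical_set_scope.

(* The root system of a complex simple Lie algebra enters only as an
   irreducible (reduced, crystallographic) root system [D] in the Euclidean
   space [V], whose inner product is [ip]. Reflections are defined through
   [ip], so [ip] is invariant under the Weyl group. *)

Section RootSystems.

Variables (R : realType) (V : vectType R) (ip : {dot V for idfun}).

Implicit Types (D P S : {fset V}) (a b theta v x y : V) (w : 'End(V)).

Definition coroot a : V := (2 / ip a a) *: a.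

Definition refl_fun a v : V := v - ip v (coroot a) *: a.

Lemma refl_fun_linear a : linear (refl_fun a).
Proof.
move=> k u v; rewrite /refl_fun linearPl /= scalerDl -scalerA scalerBr.
by rewrite opprD addrACA.
Qed.

HB.instance Definition _ a :=
  GRing.isLinear.Build R V V *:%R (refl_fun a) (@refl_fun_linear a).

Definition reflection a : 'End(V) := linfun (refl_fun a).

Lemma reflectionE a v : reflection a v = v - ip v (coroot a) *: a.
Proof. by rewrite lfunE. Qed.

Definition root_system D : Prop :=
  [/\ (<< D >> = fullv)%VS,
      0 \notin D,
      {in D, forall a (k : R), k *: a \in D -> k = 1 \/ k = -1},
      {in D &, forall a b, reflection a b \in D} &
      {in D &, forall a b, ip b (coroot a) \is a Num.int}].

Definition irreducible D : Prop :=
  D != fset0 /\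
  forall D1 D2 : {fset V}, D = (D1 `|` D2)%fset ->
    {in D1 & D2, forall a b, ip a b = 0} -> D1 = fset0 \/ D2 = fset0.

(* Reflections are involutions, so the monoid they generate is a group. *)
Inductive weyl D : 'End(V) -> Prop :=
| weyl_id : weyl D \1%VF
| weyl_refl a w : a \in D -> weyl D w -> weyl D (reflection a \o w)%VF.

Definition natcomb S v : Prop :=
  exists c : V -> nat, v = \sum_(a <- S) a *+ c a.

(* [P] is the set of simple roots of a choice of positive roots in [D] *)
Definition simple_roots D P : Prop :=
  [/\ (P `<=` D)%fset,
      basis_of fullv P &
      {in D, forall a, natcomb P a \/ natcomb P (- a)}].

Definition positive D P : set V := [set a | a \in D /\ natcomb P a].

Definition highest_root D P theta : Prop :=
  theta \in D /\ {in D, forall a, natcomb P (theta - a)}.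

(* Below, [D] is the root system, [P] its set of simple roots, [theta]
   its highest root. *)

Definition simple_coroots P : {fset V} := [fset coroot a | a in P]%fset.

Definition le_coroot P x y : Prop := natcomb (simple_coroots P) (y - x).

Definition long D theta : set V := [set a | a \in D /\ ip a a = ip theta theta].
Definition long_simple P theta : set V :=
  [set a | a \in P /\ ip a a = ip theta theta].

Definition long_coroots D theta : set V := coroot @` long D theta.
Definition pos_part D P theta : set V :=
  coroot @` (long D theta `&` positive D P).
Definition neg_part D P theta : set V := -%R @` pos_part D P theta.

(* This relation is already an equivalence: the pairs [coroot a, - coroot a],
   for distinct simple [a], are disjoint. *)
Definition glued P theta x y : Prop :=
  x = y \/ exists2 a, long_simple P theta a &
    (x = coroot a /\ y = - coroot a) \/ (x = - coroot a /\ y = coroot a).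

Definition glue_class D P theta x : set V :=
  [set y | long_coroots D theta y /\ glued P theta x y].

Definition glue_quotient D P theta : set (set V) :=
  glue_class D P theta @` long_coroots D theta.

Definition le_quotient D P theta (X Y : set V) : Prop :=
  [\/ exists x y, [/\ X x, Y y, pos_part D P theta x, pos_part D P theta y &
        le_coroot P x y],
      exists x y, [/\ X x, Y y, neg_part D P theta x, neg_part D P theta y &
        le_coroot P x y] |
      exists x y, [/\ X x, Y y, neg_part D P theta x, pos_part D P theta y &
        exists2 a, long_simple P theta a &
          le_coroot P x (- coroot a) /\ le_coroot P (coroot a) y]].

Definition grade D theta (j : int) : set V :=
  [set a | a \in D /\ ip a (coroot theta) = j%:~R].

Definition simple0 P theta : {fset V} :=
  [fset a in P | ip a (coroot theta) == 0]%fset.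

Definition le1 P theta x y : Prop := natcomb (simple0 P theta) (y - x).

Definition antichains D P theta : set (set V) :=
  [set G | G `<=` grade D theta 1 /\
           forall x y, G x -> G y -> le1 P theta x y -> x = y].

Definition upper_ideal D P theta (G : set V) : set V :=
  [set x | grade D theta 1 x /\ exists2 g, G g & le1 P theta g x].

Definition le_up D P theta (G G' : set V) : Prop :=
  upper_ideal D P theta G `<=` upper_ideal D P theta G'.

Definition minimals P theta (A : set V) : set V :=
  [set x | A x /\ forall y, A y -> le1 P theta y x -> y = x].

(* W^0 *)
Definition weyl0 D P theta : set 'End(V) :=
  [set w | weyl D w /\
           forall a, grade D theta 0 a -> positive D P a -> positive D P (w a)].

(* N(w) *)
Definition inversions D P w : set V :=
  [set a | positive D P a /\ positive D P (- w a)].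

(* [w] is in W^0 and Gamma = [G] is the set of minimal elements of
   Delta(1) \ N(w). *)
Definition represents D P theta (G : set V) w : Prop :=
  weyl0 D P theta w /\ minimals P theta (grade D theta 1 `\` inversions D P w) = G.

End RootSystems.

(* Main.v *)
Require Import Defs.
From HB Require Import structures.
From mathcomp Require Import all_boot all_order all_algebra finmap.
From mathcomp Require Import sesquilinear ring lra.
From mathcomp Require Import boolp classical_sets functions reals.

(* Sending [w] to [w theta] identifies [W^0] with the long roots, and [N(w)] is
   contained in [Delta(1)] together with [theta], where [theta] lies in [N(w)]
   iff [w theta] is negative. So [N(w)] amounts to a lower ideal of [Delta(1)]
   and one bit. Every lower ideal [L] occurs: of any two pairs
   [{x, theta - x}], [{y, theta - y}] in [Delta(1)] some members are comparable,
   so [L] cannot contain one pair and miss another, and hence [L] or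
   [L + {theta}] is biconvex. Both are biconvex exactly when [w theta] is a
   simple root [alpha], and then the two elements of [W^0] are [w] and
   [s_alpha w], with values [alpha] and [- alpha] at [theta]: this is the gluing.
   A simple reflection moves a long coroot other than [+- alpha^vee] by
   [0] or [+- alpha^vee], and in the latter case [N(w)] changes by one element; on
   coroots of one sign the dominance order is therefore the inclusion of
   inversion sets, that is, the weak order. *)

Set Implicit Arguments.
Unset Strict Implicit.
Unset Printing Implicit Defensive.

Import Order.TTheory GRing.Theory Num.Theory.
Local Open Scope ring_scope.
Local Open Scope classical_set_scope.

(** * Reflections and coroots in a Euclidean space *)

Section Form.

Variables (R : realType) (V : vectType R) (ip : {dot V for idfun}).
Implicit Types (a b u v x y : V) (k : R).

Lemma ipC x y : ip x y = ip y x.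
Proof. by rewrite hermC expr0 mul1r. Qed.

Lemma ipDl u v x : ip (u + v) x = ip u x + ip v x.
Proof. exact: linearDl. Qed.

Lemma ipZl k u x : ip (k *: u) x = k * ip u x.
Proof. exact: linearZl_LR. Qed.

Lemma ipNl u x : ip (- u) x = - ip u x.
Proof. exact: linearNl. Qed.

Lemma ipDr u v x : ip x (u + v) = ip x u + ip x v.
Proof. by rewrite ipC ipDl !(ipC x). Qed.

Lemma ipZr k u x : ip x (k *: u) = k * ip x u.
Proof. by rewrite ipC ipZl ipC. Qed.

Lemma ipNr u x : ip x (- u) = - ip x u.
Proof. by rewrite ipC ipNl ipC. Qed.

Lemma ip_suml (I : eqType) (r : seq I) (F : I -> V) x :
  ip (\sum_(i <- r) F i) x = \sum_(i <- r) ip (F i) x.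
Proof.
elim/big_rec2: _ => [|i y z _ <-]; last exact: ipDl.
by rewrite -(scale0r x) ipZl mul0r.
Qed.

Definition ipE := (ipDl, ipDr, ipZl, ipZr, ipNl, ipNr).

Lemma ip_gt0 x : x != 0 -> 0 < ip x x.
Proof. exact: neq0_dnorm_gt0. Qed.

Lemma ip_eq0 x : ip x x = 0 -> x = 0.
Proof.
by move=> x0; apply/eqP/contraT => /ip_gt0; rewrite x0 ltxx.
Qed.

(** The squared norm of [ip y y *: x - ip x y *: y] is [ip y y] times the Gram determinant of [x]
    and [y]. *)
Lemma cauchy_schwarz_lt x y : ip y y *: x != ip x y *: y ->
  ip x y ^+ 2 < ip x x * ip y y.
Proof.
have [->|y0] := eqVneq y 0; first by rewrite -(scale0r y) !ipE !mul0r !scale0r eqxx.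
rewrite -subr_eq0 => /ip_gt0.
rewrite !ipE (ipC y x) => h.
have : 0 < ip y y * (ip x x * ip y y - ip x y ^+ 2).
  by apply: lt_le_trans h _; rewrite le_eqVlt; apply/orP; left; apply/eqP; ring.
by rewrite pmulr_rgt0 ?ip_gt0 // subr_gt0.
Qed.

Lemma ip_coroot x a : ip x (coroot ip a) = 2 * ip x a / ip a a.
Proof. by rewrite /coroot ipZr mulrAC. Qed.

Lemma corootN a : coroot ip (- a) = - coroot ip a.
Proof. by rewrite /coroot !ipE opprK scalerN. Qed.

Lemma ip_coroot_self a : a != 0 -> ip a (coroot ip a) = 2.
Proof. by move=> a0; rewrite ip_coroot mulfK // lt0r_neq0 // ip_gt0. Qed.

Lemma ip_coroot_gt0 x a : a != 0 -> (0 < ip x (coroot ip a)) = (0 < ip x a).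
Proof.
move=> a0; have := ip_gt0 a0 => h.
by rewrite ip_coroot -mulrA pmulr_rgt0 // pmulr_lgt0 // invr_gt0.
Qed.

Lemma coroot_inj a b : a != 0 -> b != 0 -> coroot ip a = coroot ip b -> a = b.
Proof.
move=> a0 b0 e; have ha := ip_gt0 a0; have hb := ip_gt0 b0.
have h : forall c, c != 0 -> c = (2 / ip (coroot ip c) (coroot ip c)) *: coroot ip c.
  move=> c c0; have hc := ip_gt0 c0; rewrite /coroot !ipE scalerA.
  rewrite -[LHS]scale1r; congr (_ *: _); field; exact: lt0r_neq0.
by rewrite (h a a0) (h b b0) e.
Qed.

Lemma reflection_self a : a != 0 -> reflection ip a a = - a.
Proof.
move=> a0; rewrite reflectionE ip_coroot_self // scaler_nat mulr2n opprD addrA.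
by rewrite subrr sub0r.
Qed.

Lemma reflection_iso a x y : a != 0 ->
  ip (reflection ip a x) (reflection ip a y) = ip x y.
Proof.
move=> a0; have ha := ip_gt0 a0; rewrite !reflectionE !ip_coroot !ipE (ipC a y).
by field; apply: lt0r_neq0.
Qed.

Lemma reflectionK a : a != 0 -> involutive (reflection ip a).
Proof.
move=> a0 x; rewrite [LHS]reflectionE reflectionE.
rewrite ipDl ipNl ipZl ip_coroot_self //.
rewrite -addrA -opprD -scalerDl; set c := ip x _.
rewrite (_ : c + (c - c * 2) = 0); last by ring.
by rewrite scale0r subr0.
Qed.

Lemma reflectionN a : reflection ip (- a) = reflection ip a.
Proof. by apply/lfunP => x; rewrite !reflectionE corootN ipNr scaleNr scalerN opprK. Qed.

Lemma reflection_conj (w : 'End(V)) a x :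
  (forall x y, ip (w x) (w y) = ip x y) ->
  w (reflection ip a x) = reflection ip (w a) (w x).
Proof.
by move=> iso; rewrite !reflectionE linearB linearZ /= !ip_coroot !iso.
Qed.

Lemma coroot_iso (w : 'End(V)) a :
  (forall x y, ip (w x) (w y) = ip x y) -> w (coroot ip a) = coroot ip (w a).
Proof. by move=> iso; rewrite /coroot linearZ /= iso. Qed.

End Form.

Lemma int_gt0_ge1 (R : realType) (x : R) : x \is a Num.int -> 0 < x -> 1 <= x.
Proof. by case/intrP => z ->; rewrite ltr0z ler1z gtz0_ge1. Qed.

(** * Coordinates with respect to the simple roots, and the height *)

Section Coordinates.

Variables (R : realType) (V : vectType R) (P : {fset V}).
Implicit Types (a b v x : V).

(** Coordinates are indexed by the simple root itself instead of its position in [P]; the value 0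
    off [P] makes the function total and linear everywhere. *)
Definition scoord a v : R :=
  oapp (fun i => coord (in_tuple P) i v) 0 (insub (index a P)).

Lemma co_linear a : scalar (scoord a).
Proof.
move=> k u v; rewrite /scoord; case: insub => [i|] /=; first by rewrite linearP.
by rewrite mulr0 addr0.
Qed.

HB.instance Definition _ a := GRing.isLinear.Build R V R *%R (scoord a) (@co_linear a).

Hypothesis basisP : basis_of fullv P.

Lemma coE v : v = \sum_(a <- P) scoord a v *: a.
Proof.
rewrite [LHS](@coord_basis _ _ _ _ (in_tuple P) v basisP (memvf v)).
rewrite [RHS](big_nth 0) big_mkord; apply: eq_bigr => i _.
by rewrite /scoord index_uniq ?fset_uniq // valK.
Qed.

Lemma co_simple a b : a \in P -> b \in P -> scoord a b = (a == b)%:R.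
Proof.
move=> aP bP; have ia : (index a P < size P)%N by rewrite index_mem.
have ib : (index b P < size P)%N by rewrite index_mem.
rewrite /scoord (insubT (fun i => i < size P)%N ia) /=.
have -> : b = (in_tuple P)`_(Ordinal ib) by rewrite /= nth_index.
rewrite coord_free ?(basis_free basisP) //= -val_eqE /= nth_index // eq_sym.
congr (nat_of_bool _)%:R; apply/eqP/eqP => [e|-> //].
by rewrite -(nth_index 0 aP) e nth_index.
Qed.

Lemma co_comb a (c : V -> R) : a \in P -> scoord a (\sum_(b <- P) c b *: b) = c a.
Proof.
move=> aP; rewrite linear_sum /= (big_fsetD1 a) //= linearZ /= co_simple // eqxx.
rewrite mulr1 big_seq big1 ?addr0 // => b; rewrite in_fsetD1 => /andP[ba bP].
by rewrite linearZ /= co_simple // eq_sym (negbTE ba) mulr0.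
Qed.

Lemma natcombP v : natcomb P v <-> forall a, a \in P -> scoord a v \is a Num.nat.
Proof.
split=> [[c ->] a aP|h].
  under eq_bigr do rewrite -scaler_nat.
  by rewrite (co_comb (fun b => (c b)%:R)) // natr_nat.
exists (fun a => Num.truncn (scoord a v)).
rewrite {1}(coE v) big_seq [RHS]big_seq; apply: eq_bigr => a aP.
by rewrite -scaler_nat truncnK ?h.
Qed.

Definition height v : R := \sum_(a <- P) scoord a v.

Lemma ht_linear : scalar height.
Proof.
move=> k u v; rewrite /height mulr_sumr -big_split /=; apply: eq_bigr => a _.
by rewrite linearP.
Qed.

HB.instance Definition _ := GRing.isLinear.Build R V R *%R height ht_linear.

Lemma ht_simple a : a \in P -> height a = 1.
Proof.
move=> aP; rewrite /height (big_fsetD1 a) //= co_simple // eqxx.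
rewrite big_seq big1 ?addr0 // => b; rewrite in_fsetD1 => /andP[ba bP].
by rewrite co_simple // (negbTE ba).
Qed.

End Coordinates.

(** * Positive roots and differences of roots *)

Section RootSystem.

Variables (R : realType) (V : vectType R) (ip : {dot V for idfun}).
Variables (D P : {fset V}).
Hypotheses (rootD : root_system ip D) (simpleP : simple_roots D P).

Implicit Types (a b u v x y z : V) (w : 'End(V)) (s : seq V).

Local Notation co := (scoord P).
Local Notation ht := (height P).
Local Notation refl := (reflection ip).

Lemma basis_simple : basis_of fullv P.
Proof. by case: simpleP. Qed.

Lemma root_neq0 x : x \in D -> x != 0.
Proof. by case: rootD => _ D0 _ _ _; apply: contraTneq => ->. Qed.

Lemma root_refl a x : a \in D -> x \in D -> refl a x \in D.
Proof. by case: rootD => _ _ _ h _; apply: h. Qed.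

Lemma root_int a x : a \in D -> x \in D -> ip x (coroot ip a) \is a Num.int.
Proof. by case: rootD => _ _ _ _; apply. Qed.

Lemma root_reduced a (k : R) : a \in D -> k *: a \in D -> k = 1 \/ k = -1.
Proof. by case: rootD => _ _ h _ _ /h; apply. Qed.

Lemma opp_root x : (- x \in D) = (x \in D).
Proof.
have h y : y \in D -> - y \in D.
  by move=> yD; rewrite -(reflection_self ip (root_neq0 yD)) root_refl.
by apply/idP/idP => /h //; rewrite opprK.
Qed.

Lemma simple_root a : a \in P -> a \in D.
Proof. by case: simpleP => /fsubsetP h _ _ /h. Qed.

Lemma simple_neq0 a : a \in P -> a != 0.
Proof. by move/simple_root/root_neq0. Qed.

(** Boolean form of [positive], by the signs of real coordinates; [positiveP] shows the
    equivalence. *)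
Definition posroot x := (x \in D) && all (fun a => 0 <= co a x) P.

Lemma pos_root x : posroot x -> x \in D.
Proof. by case/andP. Qed.

Lemma pos_co x a : posroot x -> a \in P -> 0 <= co a x.
Proof. by case/andP => _ /allP h /h. Qed.

Lemma pos_simple a : a \in P -> posroot a.
Proof.
move=> aP; rewrite /posroot simple_root //=; apply/allP => b bP.
by rewrite co_simple ?basis_simple // ler0n.
Qed.

Lemma root_natcomb x : x \in D -> natcomb P x \/ natcomb P (- x).
Proof. by case: simpleP => _ _ h /h. Qed.

Lemma natcomb_pos x : x \in D -> natcomb P x -> posroot x.
Proof.
move=> xD /(natcombP basis_simple) h; rewrite /posroot xD; apply/allP => a /h.
exact: natr_ge0.
Qed.

Lemma pos_or x : x \in D -> posroot x || posroot (- x).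
Proof.
move=> xD; case: (root_natcomb xD) => /natcomb_pos -> //; first by rewrite orbT.
by rewrite opp_root.
Qed.

Lemma posN x : posroot x -> ~~ posroot (- x).
Proof.
move=> px; apply/negP => pn; have := root_neq0 (pos_root px).
rewrite (coE basis_simple x) big_seq big1 ?eqxx // => a aP.
have h1 := pos_co px aP; have := pos_co pn aP.
rewrite linearN oppr_ge0 => h2.
by rewrite (_ : co a x = 0) ?scale0r //; apply/eqP; rewrite eq_le h1 h2.
Qed.

Lemma posNE x : x \in D -> posroot (- x) = ~~ posroot x.
Proof.
move=> xD; apply/idP/idP => [h|/negbTE h]; last by have := pos_or xD; rewrite h.
by have := posN h; rewrite opprK.
Qed.

Lemma pos_natcomb x : posroot x -> natcomb P x.
Proof.
move=> px; case: (root_natcomb (pos_root px)) => // /natcomb_pos.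
by rewrite opp_root (pos_root px) (negbTE (posN px)) => /(_ isT).
Qed.

Lemma positiveP x : positive D P x <-> posroot x.
Proof.
split=> [[xD /natcomb_pos ->] //|px].
by split; [exact: pos_root | exact: pos_natcomb].
Qed.

Lemma ht_ge0 x : posroot x -> 0 <= ht x.
Proof. by move=> px; rewrite /height big_seq; apply: sumr_ge0 => a; apply: pos_co. Qed.

(** Only the coordinate at [a] changes. Were the result negative, all other coordinates of [x] would
    vanish, so [x] would be a multiple of [a], hence [a] itself. *)
Lemma pos_subZ a x (k : R) : a \in P -> posroot x -> x != a -> x - k *: a \in D ->
  posroot (x - k *: a).
Proof.
move=> aP px xa yD; have aD := simple_root aP; have xD := pos_root px.
rewrite -[posroot _]negbK -posNE //; apply/negP => pn.
have xE : x = co a x *: a.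
  rewrite {1}(coE basis_simple x) (big_fsetD1 a) //= big_seq big1 ?addr0 // => b.
  rewrite in_fsetD1 => /andP[ba bP]; have := pos_co pn bP.
  rewrite linearN linearB linearZ /= (co_simple basis_simple bP aP).
  rewrite (negbTE ba) mulr0 subr0 oppr_ge0 => h.
  by rewrite (_ : co b x = 0) ?scale0r //; apply/eqP; rewrite eq_le h pos_co.
have := xD; rewrite {1}xE => /(root_reduced aD) [] k1.
  by rewrite {1}xE k1 scale1r eqxx in xa.
by have := pos_co px aP; rewrite k1 ler0N1.
Qed.

Lemma pos_refl a x : a \in P -> posroot x -> x != a -> posroot (refl a x).
Proof.
move=> aP px xa; have := root_refl (simple_root aP) (pos_root px).
by rewrite reflectionE; apply: pos_subZ.
Qed.

(** [(x, x) > 0] is a combination of the [(x, a)] whose coefficients are the nonnegative coordinates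
    of [x]. *)
Lemma exists_simple_gt0 x : posroot x -> exists2 a, a \in P & 0 < ip x a.
Proof.
move=> px; have := ip_gt0 ip (root_neq0 (pos_root px)).
rewrite {1}(coE basis_simple x) ip_suml => h.
have [/hasP[a aP ha]|/hasPn hn] := boolP (has (fun a => 0 < ip x a) P).
  by exists a.
move: h; rewrite ltNge big_seq sumr_le0 // => a aP.
rewrite ipE ipC; apply: mulr_ge0_le0; first exact: pos_co.
by rewrite leNgt hn.
Qed.

Lemma root_cauchy_schwarz a b : a \in D -> b \in D -> a != b -> a != - b ->
  ip a b ^+ 2 < ip a a * ip b b.
Proof.
move=> aD bD anb aNb; have hb := ip_gt0 ip (root_neq0 bD).
apply: cauchy_schwarz_lt; apply/eqP => e.
have aE : a = (ip a b / ip b b) *: b.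
  by rewrite mulrC -scalerA -e scalerA mulVf ?scale1r // lt0r_neq0.
have := aD; rewrite {1}aE => /(root_reduced bD) [] k; move: aE; rewrite k.
  by rewrite scale1r => ab; rewrite ab eqxx in anb.
by rewrite scaleN1r => ab; rewrite ab eqxx in aNb.
Qed.

(** By strict Cauchy-Schwarz the product of the two Cartan integers is below 4. Both are positive,
    so one of them is 1, and the corresponding reflection yields [a - b] up to sign. *)
Lemma sub_root a b : a \in D -> b \in D -> 0 < ip a b -> a != b -> a - b \in D.
Proof.
move=> aD bD ab anb.
have a0 := root_neq0 aD; have b0 := root_neq0 bD.
have ha := ip_gt0 ip a0; have hb := ip_gt0 ip b0.
have : ip a b ^+ 2 < ip a a * ip b b.
  apply: root_cauchy_schwarz => //; apply: contraTneq ab => ->.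
  by rewrite ipNl oppr_gt0 -leNgt ltW.
have ma : 0 < ip a (coroot ip b) by rewrite ip_coroot_gt0.
have mb : 0 < ip b (coroot ip a) by rewrite ip_coroot_gt0 // ipC.
have ia := root_int bD aD; have ib := root_int aD bD.
have [m1|m1] := eqVneq (ip a (coroot ip b)) 1.
  by move=> _; have := root_refl bD aD; rewrite reflectionE m1 scale1r.
have [n1|n1] := eqVneq (ip b (coroot ip a)) 1.
  by move=> _; have := root_refl aD bD; rewrite reflectionE n1 scale1r -opp_root opprB.
have ge2 (t : R) : t \is a Num.int -> 0 < t -> t != 1 -> 2 <= t.
  move=> ti t0 tn; rewrite -lerBrDr; apply: int_gt0_ge1; first by rewrite rpredB ?rpred1.
  by rewrite subr_gt0 lt_neqAle eq_sym tn int_gt0_ge1.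
have h4 : 4 <= ip a (coroot ip b) * ip b (coroot ip a).
  by rewrite (_ : 4 = 2 * 2 :> R) ?ler_pM ?ler0n ?ge2 //; ring.
move: h4; rewrite !ip_coroot (ipC ip b a) => h4 h.
suff: 4 * (ip a a * ip b b) <= 4 * (ip a b ^+ 2) by rewrite ler_pM2l ?ltr0n // leNgt h.
have h0 : 0 < ip a a * ip b b by rewrite mulr_gt0.
have := ler_wpM2r (ltW h0) h4 => {}h4; apply: le_trans h4 _.
rewrite le_eqVlt; apply/orP; left; apply/eqP.
by field; rewrite !lt0r_neq0.
Qed.

(** * The Weyl group: words in simple reflections, exchange, positive systems *)

Lemma weyl_iso w : weyl ip D w -> forall x y, ip (w x) (w y) = ip x y.
Proof.
elim=> [x y|a {}w aD _ IH x y]; first by rewrite !id_lfunE.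
by rewrite !comp_lfunE reflection_iso ?root_neq0.
Qed.

Lemma weyl_root w x : weyl ip D w -> x \in D -> w x \in D.
Proof.
move=> W xD; elim: W => [|a {}w aD _ IH]; first by rewrite id_lfunE.
by rewrite comp_lfunE root_refl.
Qed.

Lemma weyl_comp w w' : weyl ip D w -> weyl ip D w' -> weyl ip D (w \o w')%VF.
Proof.
move=> W W'; elim: W => [|a {}w aD _ IH]; first by rewrite comp_lfun1l.
by rewrite -comp_lfunA; apply: weyl_refl.
Qed.

Lemma weyl_reflection a : a \in D -> weyl ip D (refl a).
Proof. by move=> aD; rewrite -[refl a]comp_lfun1r; do !constructor. Qed.

Lemma weyl_inj w : weyl ip D w -> lker w == 0%VS.
Proof.
move=> W; apply/lker0P => x y e; apply/eqP; rewrite -subr_eq0; apply/eqP.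
by apply: (@ip_eq0 _ _ ip); rewrite -(weyl_iso W) linearB /= e subrr -(scale0r 0) ipZl mul0r.
Qed.

Lemma weyl_K w : weyl ip D w -> cancel w w^-1%VF.
Proof. by move=> W; apply: lker0_lfunK; apply: weyl_inj. Qed.

Lemma weyl_inv w : weyl ip D w -> weyl ip D w^-1%VF /\ cancel w^-1%VF w.
Proof.
move=> W; suff [w' W' K] : exists2 w', weyl ip D w' & cancel w' w.
  have <- : w' = w^-1%VF by apply/lfunP => x; rewrite -{2}[x]K (weyl_K W).
  by [].
elim: W => [|a {}w aD W [w' W' K]].
  by exists \1%VF; [constructor | move=> x; rewrite !id_lfunE].
exists (w' \o refl a)%VF; first by apply: weyl_comp => //; apply: weyl_reflection.
by move=> x; rewrite !comp_lfunE K reflectionK ?root_neq0.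
Qed.

Lemma weyl_VK w : weyl ip D w -> cancel w^-1%VF w.
Proof. by case/weyl_inv. Qed.

Lemma weyl_V w : weyl ip D w -> weyl ip D w^-1%VF.
Proof. by case/weyl_inv. Qed.

Definition wordprod s : 'End(V) := foldr (fun a w => (refl a \o w)%VF) \1%VF s.

Lemma wordprod_cat s1 s2 : wordprod (s1 ++ s2) = (wordprod s1 \o wordprod s2)%VF.
Proof. by elim: s1 => [|a s IH] /=; rewrite ?comp_lfun1l // IH comp_lfunA. Qed.

Lemma wordprod_weyl s : {subset s <= P} -> weyl ip D (wordprod s).
Proof.
elim: s => [|a s IH] h /=; first by constructor.
constructor; first by apply/simple_root/h; rewrite inE eqxx.
by apply: IH => x xs; apply: h; rewrite inE xs orbT.
Qed.

Lemma ht_refl_lt a x : a \in P -> x \in D -> 0 < ip x a -> ht (refl a x) <= ht x - 1.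
Proof.
move=> aP xD xa; have aD := simple_root aP.
rewrite reflectionE linearB linearZ /= (ht_simple basis_simple aP) mulr1 lerD2l lerN2.
by apply: int_gt0_ge1; [exact: root_int | rewrite ip_coroot_gt0 ?root_neq0].
Qed.

(** Heights of positive roots are nonnegative, and each descent lowers them by at least 1. *)
Lemma pos_ind (Q : V -> Prop) :
  (forall x, posroot x -> (forall y, posroot y -> ht y <= ht x - 1 -> Q y) -> Q x) ->
  forall x, posroot x -> Q x.
Proof.
move=> step x px.
have [n] : exists n : nat, ht x < n%:R.
  by exists (Num.truncn (ht x)).+1; apply: truncnS_gt.
elim: n x px => [|n IH] x px hx; first by have := ht_ge0 px; rewrite leNgt hx.
apply: step => // y py hy; apply: IH => //.
by apply: le_lt_trans hy _; rewrite ltrBlDr natr1.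
Qed.

(** For a simple [a] pairing positively with [b], the root [c = s_a b] has smaller height and
    [s_b = s_a s_c s_a]. *)
Lemma reflection_word b : posroot b -> exists2 s, {subset s <= P} & refl b = wordprod s.
Proof.
move: b; apply: pos_ind => b pb IH.
have [bP|bP] := boolP (b \in P).
  exists [:: b]; last by rewrite /= comp_lfun1r.
  by move=> x; rewrite inE => /eqP ->.
have [a aP ba] := exists_simple_gt0 pb; have a0 := simple_neq0 aP.
have bna : b != a by apply: contraNneq bP => ->.
have [s sP es] := IH _ (pos_refl aP pb bna) (ht_refl_lt aP (pos_root pb) ba).
exists (a :: rcons s a).
  move=> x; rewrite inE mem_rcons inE orbA orbb => /orP[/eqP->|/sP] //.
rewrite /= -cats1 wordprod_cat -es /= comp_lfun1r; apply/lfunP => x.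
rewrite !comp_lfunE (@reflection_conj _ _ ip) ?reflectionK //.
by move=> y z; apply: reflection_iso.
Qed.

Lemma weyl_word w : weyl ip D w -> exists2 s, {subset s <= P} & w = wordprod s.
Proof.
elim=> [|a {}w aD _ [s sP ->]]; first by exists [::].
have [t tP ->] : exists2 s, {subset s <= P} & refl a = wordprod s.
  by case/orP: (pos_or aD) => /reflection_word //; rewrite reflectionN.
by exists (t ++ s); rewrite ?wordprod_cat // => x; rewrite mem_cat => /orP[/tP|/sP].
Qed.

(** Letters act from the right end of the word. The letter that first turns the image of [b]
    negative must equal that image, because a simple reflection changes the sign of no other
    positive root. *)
Lemma exchange s b : {subset s <= P} -> posroot b -> ~~ posroot (wordprod s b) ->
  exists s1 a s2, s = s1 ++ a :: s2 /\ wordprod s2 b = a.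
Proof.
elim: s => [|a s IH] sP pb /=; first by rewrite id_lfunE pb.
have aP : a \in P by apply: sP; rewrite inE eqxx.
have sP' : {subset s <= P} by move=> x xs; apply: sP; rewrite inE xs orbT.
rewrite comp_lfunE => h.
have [psb|/IH] := boolP (posroot (wordprod s b)); last first.
  by case=> // s1 [a' [s2 [-> e]]]; exists (a :: s1), a', s2.
exists [::], a, s; split=> //; apply/eqP; apply: contraNT h => h.
exact: pos_refl.
Qed.

(** If a word for [w] ends in [b], the rest of the word sends [b] to a negative root; by [exchange]
    two letters can then be deleted, and induction on the length applies. *)
Lemma weyl_pos_id w : weyl ip D w -> (forall x, posroot x -> posroot (w x)) -> w = \1%VF.
Proof.
case/weyl_word => s sP ->; have [n] := ubnP (size s); elim: n s sP => // n IH s.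
case/lastP: s => [|s b] // sP; rewrite size_rcons ltnS => sn h.
have bP : b \in P by apply: sP; rewrite mem_rcons inE eqxx.
have sP' : {subset s <= P} by move=> x xs; apply: sP; rewrite mem_rcons inE xs orbT.
have b0 := simple_neq0 bP.
have nb : ~~ posroot (wordprod s b).
  have := h _ (pos_simple bP); rewrite -cats1 wordprod_cat /= comp_lfun1r comp_lfunE.
  rewrite reflection_self // linearN => /posN; rewrite opprK //.
have [s1 [a [s2 [es e2]]]] := exchange sP' (pos_simple bP) nb.
have eq12 : wordprod (rcons s b) = wordprod (s1 ++ s2).
  rewrite -cats1 es -catA !wordprod_cat /= comp_lfun1r.
  congr (_ \o _)%VF; apply/lfunP => x; rewrite !comp_lfunE.
  have W2 : weyl ip D (wordprod s2).
    by apply: wordprod_weyl => y ys; apply: sP'; rewrite es mem_cat inE ys !orbT.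
  rewrite (reflection_conj _ _ (weyl_iso W2)) e2 reflectionK //.
  by apply: simple_neq0; apply: sP'; rewrite es mem_cat inE eqxx orbT.
rewrite eq12; apply: IH; last by move=> x; rewrite -eq12; apply: h.
  by move=> x; rewrite mem_cat => xs; apply: sP'; rewrite es mem_cat inE orbCA xs orbT.
by apply: leq_trans sn; rewrite es !size_cat /= addnS.
Qed.

(* Induction on the number of negative roots in [C]: if a simple root [a] is not
   in [C], the reflection in [a] turns [C] into a set with one negative root
   fewer. *)
Lemma weyl_positive_system (C : pred V) :
    (forall x, x \in D -> C (- x) = ~~ C x) ->
    (forall x y z, [/\ x \in D, y \in D & z \in D] -> [/\ C x, C y & C z] ->
      x + y + z != 0) ->
  exists2 w, weyl ip D w & forall x, x \in D -> C x = posroot (w x).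
Proof.
have [n] := ubnP #|` [fset x in D | C x && posroot (- x)]%fset|.
elim: n C => // n IH C; rewrite ltnS => hn CN Cadd.
have [/allP simC|/allPn[a aP aC]] := boolP (all C P).
  exists \1%VF; first by constructor.
  suff h : forall x, posroot x -> C x.
    move=> x xD; rewrite id_lfunE; apply/idP/idP => [Cx|/h //].
    by apply: contraLR Cx; rewrite -posNE // -CN //; apply: h.
  apply: pos_ind => x px IHx; have xD := pos_root px.
  have [/simC //|xP] := boolP (x \in P).
  (* The root [x] splits as [(x - a) + a] with both summands in [C]; if [- x] were in [C] too, three
     elements of [C] would sum to 0. *)
  have [a aP xa] := exists_simple_gt0 px.
  have xna : x != a by apply: contraNneq xP => ->.
  have aD := simple_root aP; have yD := sub_root xD aD xa xna.
  have py : posroot (x - a) by rewrite -[a]scale1r pos_subZ ?scale1r.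
  apply: contraT => Cx; have := @Cadd (x - a) a (- x).
  rewrite subrK subrr eqxx; apply.
    by split=> //; rewrite opp_root.
  split; [|exact: simC|by rewrite CN].
  by apply: IHx => //; rewrite linearB /= (ht_simple basis_simple aP).
have aD := simple_root aP; have a0 := root_neq0 aD.
have refD x : (refl a x \in D) = (x \in D).
  by apply/idP/idP => /(root_refl aD) //; rewrite reflectionK.
have [|x xD|x y z [xD yD zD] [Cx Cy Cz]|w W wE] := IH (fun x => C (refl a x)).
- apply: leq_trans hn; set S := [fset x in D | _]%fset.
  have -> : #|` S| = #|` [fset refl a x | x in S]%fset|.
    by rewrite [RHS]card_imfset //; exact: inv_inj (reflectionK ip a0).
  apply: fproper_ltn_card; apply: fsub_proper_trans (@fproperD1 _ _ (- a) _); last first.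
    by rewrite !inE /= opp_root opprK aD CN // aC pos_simple.
  apply/fsubsetP => _ /imfsetP[x /= + ->]; rewrite /S !inE /= => /and3P[xD Cx px].
  have xna : - x != a.
    apply: contraNneq aC => e; move: Cx.
    by rewrite -[x]opprK e linearN /= reflection_self // opprK.
  rewrite refD xD Cx /= -linearN pos_refl // !andbT.
  apply: contraTneq px => /(congr1 (refl a)); rewrite reflectionK // linearN /=.
  by rewrite reflection_self // opprK => ->; apply/posN/pos_simple.
- by rewrite linearN /= CN // refD.
- have := Cadd _ _ _ _ (And3 Cx Cy Cz); rewrite -!linearD /= !refD => /(_ (And3 xD yD zD)).
  by apply: contraNneq => ->; rewrite linear0.
exists (w \o refl a)%VF; first by apply: weyl_comp => //; apply: weyl_reflection.
by move=> x xD; rewrite comp_lfunE -wE ?refD // reflectionK.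
Qed.

End RootSystem.

(** * Nonnegative integer combinations *)

Section NatComb.

Variables (R : realType) (V : vectType R).
Implicit Types (S : {fset V}) (a v : V).

(** The number [n] of summands, counted with multiplicity, serves as the induction measure for the
    dominance order. *)
Definition natcombn S n v : Prop :=
  exists2 c : V -> nat, v = \sum_(a <- S) a *+ c a & (\sum_(a <- S) c a)%N = n.

Lemma natcomb0 S : natcomb S 0.
Proof. by exists (fun=> 0); rewrite big1. Qed.

Lemma natcombD S u v : natcomb S u -> natcomb S v -> natcomb S (u + v).
Proof.
move=> [c ->] [d ->]; exists (fun a => c a + d a)%N.
by rewrite -big_split; apply: eq_bigr => a _; rewrite mulrnDr.
Qed.

Lemma natcomb_mem S a : a \in S -> natcomb S a.
Proof.
move=> aS; exists (fun b => (b == a) : nat).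
rewrite (big_fsetD1 a) //= eqxx big_seq big1 ?addr0 // => b.
by rewrite in_fsetD1 => /andP[/negbTE-> _].
Qed.

Lemma natcombZ S (k : R) v : k \is a Num.nat -> natcomb S v -> natcomb S (k *: v).
Proof.
case/natrP => n -> [c ->]; exists (fun a => c a * n)%N.
by rewrite scaler_nat -sumrMnl; apply: eq_bigr => a _; rewrite mulrnA.
Qed.

(** [(v, v) > 0] is the sum of the [(v, a)] over the summands [a], so some summand that occurs pairs
    positively with [v] and can be removed. *)
Lemma natcombn_step (ip : {dot V for idfun}) S n v : natcombn S n v -> v != 0 ->
  exists a, [/\ a \in S, 0 < ip v a, (0 < n)%N & natcombn S n.-1 (v - a)].
Proof.
case=> c ev <- v0; have := ip_gt0 ip v0; rewrite {1}ev ip_suml => h.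
have [/hasP[a aS /andP[ha ca]]|/hasPn hn] :=
  boolP (has (fun a => (0 < ip v a) && (0 < c a)%N) S); last first.
  move: h; rewrite ltNge big_seq sumr_le0 // => a aS.
  rewrite -scaler_nat ipE ipC; have := hn a aS; rewrite negb_and -leNgt -eqn0Ngt.
  by case/orP => [|/eqP->]; [apply: mulr_ge0_le0; rewrite ler0n | rewrite mul0r].
have cE : (\sum_(b <- S) c b = c a + \sum_(b <- (S `\ a)%fset) c b)%N.
  by rewrite (big_fsetD1 a).
exists a; split=> //; first by rewrite cE ltn_addr.
exists (fun b => if b == a then (c b).-1 else c b).
  rewrite ev [LHS]addrC !(big_fsetD1 a aS) /= eqxx addrA -{1}(prednK ca) mulrS addKr.
  congr (_ + _); rewrite big_seq [RHS]big_seq; apply: eq_bigr => b.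
  by rewrite in_fsetD1 => /andP[/negbTE-> _].
rewrite (big_fsetD1 a aS) /= eqxx cE -{2}(prednK ca) addSn /=; congr (_ + _)%N.
rewrite big_seq [RHS]big_seq; apply: eq_bigr => b.
by rewrite in_fsetD1 => /andP[/negbTE-> _].
Qed.

End NatComb.

(** * The highest root: dominance, maximal length, and the grading it defines *)

Section HighestRoot.

Variables (R : realType) (V : vectType R) (ip : {dot V for idfun}).
Variables (D P : {fset V}) (theta : V).
Hypotheses (rootD : root_system ip D) (simpleP : simple_roots D P).
Hypothesis highestT : highest_root D P theta.

Implicit Types (a b u v x y z : V) (w : 'End(V)).

Local Notation refl := (reflection ip).
Local Notation coroot := (coroot ip).
Local Notation pos := (posroot D P).
Local Notation co := (scoord P).
Local Notation ht := (height P).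
Local Notation basis := (basis_simple simpleP).
Local Notation neq0 := (root_neq0 rootD).
Local Notation sroot := (simple_root simpleP).
Local Notation gr x := (ip x (coroot theta)).
Local Notation wroot := (weyl_root rootD).
Local Notation wiso := (weyl_iso rootD).

Lemma theta_root : theta \in D.
Proof. by case: highestT. Qed.

Lemma theta_neq0 : theta != 0.
Proof. exact: neq0 theta_root. Qed.

Lemma natcomb_co_ge0 a v : natcomb P v -> a \in P -> 0 <= co a v.
Proof. by move/(natcombP basis) => h /h; apply: natr_ge0. Qed.

Lemma theta_pos : pos theta.
Proof.
rewrite /posroot theta_root; apply/allP => a aP.
case: highestT => _ /(_ (- theta)); rewrite (opp_root rootD) theta_root => /(_ isT).
rewrite opprK => /natcomb_co_ge0 /(_ aP); rewrite linearD /= => h.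
by rewrite -(@pmulrn_lge0 _ _ 2) // mulr2n.
Qed.

Lemma theta_dominant a : a \in P -> 0 <= ip theta a.
Proof.
move=> aP; rewrite leNgt; apply/negP => h; have aD := sroot aP.
case: highestT => _ /(_ (refl a theta)); rewrite root_refl ?theta_root // => /(_ isT).
move/natcomb_co_ge0 => /(_ _ aP).
rewrite reflectionE opprB addrC subrK linearZ /= (co_simple basis aP aP) eqxx mulr1.
by rewrite leNgt -oppr_gt0 -ipNl ip_coroot_gt0 ?neq0 // ipNl oppr_gt0 h.
Qed.

Lemma dominant_ge0 u v : (forall a, a \in P -> 0 <= co a u) ->
  (forall a, a \in P -> 0 <= ip v a) -> 0 <= ip u v.
Proof.
move=> hu hv; rewrite (coE basis u) ip_suml big_seq; apply: sumr_ge0 => a aP.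
by rewrite ipE ipC mulr_ge0 ?hu ?hv.
Qed.

Lemma pos_theta_ge0 x : pos x -> 0 <= ip x theta.
Proof.
by move=> px; apply: dominant_ge0 theta_dominant => a aP; exact: pos_co px aP.
Qed.

(** [theta - v] has nonnegative coordinates, so it pairs nonnegatively with [v] and with [theta],
    whence [(v, v) <= (v, theta) <= (theta, theta)]. Equality at both ends makes [theta - v] of norm
    0. *)
Lemma dominant_root v : v \in D -> (forall a, a \in P -> 0 <= ip v a) ->
  ip v v <= ip theta theta /\ (ip v v = ip theta theta -> v = theta).
Proof.
move=> vD hv; have nc : forall a, a \in P -> 0 <= co a (theta - v).
  by move=> a; apply: natcomb_co_ge0; case: highestT => _; apply.
have := dominant_ge0 nc hv; have := dominant_ge0 nc theta_dominant.
rewrite !ipE (ipC ip v theta) => h1 h2; split; first by lra.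
move=> e; apply/eqP; rewrite -subr_eq0; apply/eqP/(@ip_eq0 _ _ ip).
by rewrite !ipE (ipC ip v theta); lra.
Qed.

(** Reflecting in a simple root that pairs negatively with [v] raises the height by at least 1, and
    the height of [theta] is an upper bound. *)
Lemma climb_ind (Q : V -> Prop) :
  (forall v, v \in D -> (forall a, a \in P -> ip v a < 0 -> Q (refl a v)) -> Q v) ->
  forall v, v \in D -> Q v.
Proof.
move=> step v vD.
have [n] : exists n : nat, ht (theta - v) < n%:R.
  by exists (Num.truncn (ht (theta - v))).+1; apply: truncnS_gt.
elim: n v vD => [|n IH] v vD hv.
  move: hv; rewrite ltNge /height big_seq sumr_ge0 // => a.
  by apply: natcomb_co_ge0; case: highestT => _; apply.
apply: step => // a aP va; apply: IH; first exact: (root_refl rootD (sroot aP) vD).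
have := @ht_refl_lt _ _ _ _ _ rootD simpleP a (- v) aP.
rewrite (opp_root rootD) ipNl oppr_gt0 => /(_ vD va).
by move: hv; rewrite !linearB /= !linearN /= -natr1; lra.
Qed.

Lemma theta_longest v : v \in D -> ip v v <= ip theta theta.
Proof.
move: v; apply: climb_ind => v vD IH.
have [/allP hn|/allPn[a aP]] := boolP (all (fun a => 0 <= ip v a) P).
  by case: (dominant_root vD hn).
by rewrite -ltNge => /(IH a aP); rewrite reflection_iso ?neq0 ?sroot.
Qed.

(** As [v] has maximal length, strict Cauchy-Schwarz gives [|(x, v)| < (v, v)]; the pairing with the
    coroot is thus an integer of absolute value below 2. *)
Lemma long_pairing v x : long ip D theta v -> x \in D -> x != v -> x != - v ->
  `|ip x (coroot v)| <= 1.
Proof.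
move=> [vD vl] xD xv xNv; have v0 := neq0 vD; have hv := ip_gt0 ip v0.
have : ip x v ^+ 2 < ip x x * ip v v by exact: (root_cauchy_schwarz rootD xD vD xv xNv).
move=> h; have : ip x v ^+ 2 < ip v v ^+ 2.
  by apply: lt_le_trans h _; rewrite expr2 ler_pM2r // vl theta_longest.
rewrite -real_normK ?num_real // ltr_pXn2r ?nnegrE ?normr_ge0 ?(ltW hv) // => h2.
have : `|ip x (coroot v)| < 2.
  rewrite ip_coroot !normrM normfV (gtr0_norm hv) (gtr0_norm (_ : 0 < 2)) ?ltr0n //.
  by rewrite ltr_pdivrMr // ltr_pM2l ?ltr0n.
have /intrP[n ->] := root_int rootD vD xD.
by rewrite -intr_norm -[2]/(2%:~R) -[1]/(1%:~R) ltr_int ler_int; case: (`|n|) => // -[|[]].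
Qed.

Lemma gr_theta : gr theta = 2.
Proof. by rewrite ip_coroot_self ?theta_neq0. Qed.

(** By [long_pairing] at [theta], every root other than [theta] and [- theta] has grade -1, 0 or
    1. *)
Lemma grP x : x \in D -> [\/ x = theta, x = - theta | [\/ gr x = 1, gr x = 0 | gr x = -1]].
Proof.
move=> xD; have [->|xt] := eqVneq x theta; first by constructor 1.
have [->|xNt] := eqVneq x (- theta); first by constructor 2.
have tl : long ip D theta theta by split; rewrite ?theta_root.
have := long_pairing tl xD xt xNt; have /intrP[n ->] := root_int rootD theta_root xD.
rewrite -intr_norm -[X in _ <= X]/(1%:~R) ler_int => h; constructor 3.
case: n h => [[|[|n]]|[|n]] // _; [constructor 2|constructor 1|constructor 3] => //.
Qed.

Lemma gr_gt0 x : (0 < gr x) = (0 < ip x theta).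
Proof. by rewrite ip_coroot_gt0 ?theta_neq0. Qed.

Lemma gr_pos x : x \in D -> 0 < gr x -> pos x.
Proof.
move=> xD; rewrite gr_gt0 => h; rewrite -[pos x]negbK -(posNE rootD) //.
by apply/negP => /pos_theta_ge0; rewrite ipNl oppr_ge0 leNgt h.
Qed.

Lemma pos_gr x : pos x -> 0 <= gr x.
Proof.
move=> px; rewrite -oppr_le0 -ipNl leNgt gr_gt0 ipNl oppr_gt0 -leNgt.
exact: pos_theta_ge0.
Qed.

End HighestRoot.

(** * Elements of [W^0], their inversion sets and the weak order *)

Section MinimalRepresentatives.

Variables (R : realType) (V : vectType R) (ip : {dot V for idfun}).
Variables (D P : {fset V}) (theta : V).
Hypotheses (rootD : root_system ip D) (simpleP : simple_roots D P).
Hypothesis highestT : highest_root D P theta.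

Implicit Types (a b u v x y z : V) (w : 'End(V)).

Local Notation refl := (reflection ip).
Local Notation coroot := (coroot ip).
Local Notation pos := (posroot D P).
Local Notation co := (scoord P).
Local Notation ht := (height P).
Local Notation basis := (basis_simple simpleP).
Local Notation neq0 := (root_neq0 rootD).
Local Notation sroot := (simple_root simpleP).
Local Notation gr x := (ip x (coroot theta)).
Local Notation wroot := (weyl_root rootD).
Local Notation wiso := (weyl_iso rootD).
Local Notation theta_root := (theta_root highestT).
Local Notation gr_pos := (gr_pos rootD simpleP highestT).
Local Notation pos_gr := (pos_gr rootD simpleP highestT).
Local Notation grP := (grP rootD simpleP highestT).
Local Notation gr_theta := (gr_theta rootD highestT).

Local Notation W0 := (weyl0 ip D P theta).

(** Boolean counterpart of [inversions]: for a Weyl group element and a root, exactly one of [w x]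
    and [- w x] is positive. *)
Definition inverts w x := pos x && ~~ pos (w x).

Lemma W0_weyl w : W0 w -> weyl ip D w.
Proof. by case. Qed.

Lemma W0P w : W0 w <->
  weyl ip D w /\ forall x, gr x = 0 -> pos x -> pos (w x).
Proof.
split=> -[W h]; split=> // x.
  by move=> x0 px; apply/(positiveP rootD simpleP)/h; [split=> //; exact: pos_root px |
    apply/(positiveP rootD simpleP)].
by case=> xD x0 /(positiveP rootD simpleP) px; apply/(positiveP rootD simpleP)/h.
Qed.

Lemma W0_pos w x : W0 w -> x \in D -> gr x = 0 -> pos (w x) = pos x.
Proof.
case/W0P => W h xD x0; apply/idP/idP => [|/h]; last exact.
apply: contraLR; rewrite -!(posNE rootD simpleP) ?wroot // -linearN; apply: h.
by rewrite ipNl x0 oppr0.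
Qed.

Lemma W0_id : W0 \1%VF.
Proof. by apply/W0P; split=> [|x _]; rewrite ?id_lfunE //; constructor. Qed.

Lemma inv_pos w x : inverts w x -> pos x.
Proof. by case/andP. Qed.

(** Elements of [W^0] preserve the sign of roots of grade 0, and positive roots have nonnegative
    grade. *)
Lemma inv_gr w x : W0 w -> inverts w x -> x = theta \/ gr x = 1.
Proof.
move=> Ww /andP[px nx]; have xD := pos_root px; have := pos_gr px.
case: (grP xD) => [->|->|[->|x0|->]]; [by left| |by right| |by rewrite ler0N1].
  by rewrite ipNl gr_theta oppr_ge0 lern0.
by move: nx; rewrite (W0_pos Ww) // px.
Qed.

Lemma gr_iso w x : weyl ip D w -> ip (w x) (coroot (w theta)) = gr x.
Proof. by move=> W; rewrite !ip_coroot !(wiso W). Qed.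

Lemma pos_reflE a x : a \in P -> x \in D -> x != a -> x != - a ->
  pos (refl a x) = pos x.
Proof.
move=> aP xD xa xNa; apply/idP/idP => [|px]; last exact: (pos_refl rootD simpleP).
apply: contraLR; rewrite -!(posNE rootD simpleP) ?(root_refl rootD (sroot aP)) // -linearN.
by move=> px; apply: (pos_refl rootD simpleP) => //; rewrite eqr_oppLR.
Qed.

(** The reflection could spoil a positive [x] of grade 0 only if [w x = a], but then
    [(w theta, a) = (theta, x) = 0]. *)
Lemma W0_refl w a : W0 w -> a \in P -> ip (w theta) a != 0 -> W0 (refl a \o w)%VF.
Proof.
move=> Ww aP wa; have W := W0_weyl Ww; apply/W0P; split; first by apply: weyl_refl => //; apply: sroot.
move=> x x0 px; rewrite comp_lfunE; apply: (pos_refl rootD simpleP) => //.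
  by rewrite (W0_pos Ww) ?(pos_root px).
apply: contraNneq wa => <-; rewrite (wiso W) ipC.
move/eqP: x0; rewrite ip_coroot mulf_eq0 invr_eq0 mulf_eq0 pnatr_eq0 /=.
by rewrite (gt_eqF (ip_gt0 ip (neq0 theta_root))) orbF.
Qed.

Section Step.

Variables (w : 'End(V)) (a : V).
Hypotheses (Ww : W0 w) (aP : a \in P) (wa : 0 < ip (w theta) a).

Let W := W0_weyl Ww.
Let x0 := w^-1%VF a.

Lemma step_W0 : W0 (refl a \o w)%VF.
Proof. by apply: W0_refl => //; rewrite gt_eqF. Qed.

Lemma step_root : x0 \in D.
Proof. exact/(wroot (weyl_V rootD W))/sroot. Qed.

Lemma step_wK : w x0 = a.
Proof. exact: (weyl_VK rootD W). Qed.

Lemma step_pos : pos x0.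
Proof.
apply: gr_pos step_root _; rewrite -(gr_iso _ W) step_wK ip_coroot_gt0; first by rewrite ipC.
exact/neq0/wroot/theta_root.
Qed.

(** The simple reflection changes the sign of [a] and [- a] only, so among positive roots only [x0],
    with [w x0 = a], changes status. It is positive because it pairs positively with [theta]. *)
Lemma step_inv x : inverts (refl a \o w)%VF x = inverts w x || (x == x0).
Proof.
have a0 := simple_neq0 rootD simpleP aP.
rewrite /inverts comp_lfunE; have [px|npx] /= := boolP (pos x); last first.
  by apply/esym/negbTE; apply: contraNneq npx => ->; exact: step_pos.
have xD := pos_root px.
have [->|xx0] := eqVneq x x0.
  rewrite orbT step_wK reflection_self //; apply/(posN rootD simpleP).
  exact: (pos_simple simpleP).
rewrite orbF pos_reflE ?wroot //.
  by apply: contraNneq xx0 => e; rewrite -(weyl_K rootD W x) e.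
apply: contraTneq px => e.
have -> : x = - x0 by rewrite -(weyl_K rootD W x) e linearN.
exact/(posN rootD simpleP)/step_pos.
Qed.

End Step.

Lemma weyl_eq w w' : weyl ip D w -> weyl ip D w' ->
  (forall x, pos x -> pos (w x) = pos (w' x)) -> w = w'.
Proof.
move=> W W' h.
have hD x : x \in D -> pos (w x) = pos (w' x).
  move=> xD; case/orP: (pos_or rootD simpleP xD) => [/h //|/h].
  by rewrite !linearN !(posNE rootD simpleP) ?wroot // => /negb_inj.
have : (w' \o w^-1)%VF = \1%VF.
  apply: (weyl_pos_id rootD simpleP); first exact/weyl_comp/weyl_V.
  move=> x px; rewrite comp_lfunE -hD ?(weyl_VK rootD W) //.
  exact: (wroot (weyl_V rootD W) (pos_root px)).
move/lfunP => e; apply/lfunP => x.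
by have := e (w x); rewrite comp_lfunE (weyl_K rootD W) id_lfunE.
Qed.

(** [u = w^-1 w'] fixes [theta], so it preserves grades and hence positivity in positive grade; in
    grade 0 positivity is preserved since [w] and [w'] are in [W^0]. So [u] is the identity. *)
Lemma W0_eq w w' : W0 w -> W0 w' -> w theta = w' theta -> w = w'.
Proof.
move=> Ww Ww' e; have W := W0_weyl Ww; have W' := W0_weyl Ww'.
have WV := weyl_V rootD W; pose u := (w^-1 \o w')%VF.
have Wu : weyl ip D u by apply: weyl_comp.
have ut : u theta = theta by rewrite comp_lfunE -e (weyl_K rootD W).
have wu x : w (u x) = w' x by rewrite comp_lfunE (weyl_VK rootD W).
have gu x : gr (u x) = gr x by rewrite -[in LHS]ut gr_iso.
have /lfunP uid : u = \1%VF.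
  apply: (weyl_pos_id rootD simpleP) => // x px; have xD := pos_root px.
  have := pos_gr px; rewrite le_eqVlt => /orP[/eqP x0|]; last first.
    by rewrite -gu; apply: gr_pos; apply: wroot.
  by rewrite -(W0_pos Ww) ?wroot ?gu // wu (W0_pos Ww').
by apply/lfunP => x; rewrite -wu uid id_lfunE.
Qed.

Lemma W0_inv_eq w w' : W0 w -> W0 w' -> inverts w =1 inverts w' -> w = w'.
Proof.
move=> Ww Ww' h; apply: weyl_eq; [exact: W0_weyl|exact: W0_weyl|].
by move=> x px; have := h x; rewrite /inverts px => /negb_inj.
Qed.

(** If [w w'^-1] kept all simple roots positive, it would keep [w' x] positive, against
    [inverts w x]. So some simple [a] is sent to a negative root. Here [w'^-1 a] is positive, as
    otherwise its opposite would be inverted by [w'] and not by [w]. *)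
Lemma weak_step w w' x : W0 w -> W0 w' -> (forall y, inverts w' y -> inverts w y) ->
    inverts w x -> ~~ inverts w' x ->
  exists a, [/\ a \in P, 0 < ip (w' theta) a, inverts w (w'^-1%VF a), ~~ inverts w' (w'^-1%VF a) &
    forall y, inverts (refl a \o w')%VF y -> inverts w y].
Proof.
move=> Ww Ww' sub wx w'x; have W := W0_weyl Ww; have W' := W0_weyl Ww'.
have WV := weyl_V rootD W'.
have w'K y : w' (w'^-1%VF y) = y by exact: (weyl_VK rootD W').
have [/allP h|/allPn[a aP na]] := boolP (all (fun a => pos (w (w'^-1%VF a))) P).
  have px := inv_pos wx; have xD := pos_root px.
  have : pos (w' x) by move: w'x; rewrite /inverts px negbK.
  move=> pw'x; case/andP: wx => _ /negP []; rewrite /posroot wroot //=.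
  apply/allP => b bP; rewrite -(weyl_K rootD W' x) (coE basis (w' x)).
  rewrite !linear_sum /= big_seq sumr_ge0 // => a aP.
  by rewrite !linearZ /= mulr_ge0 ?(pos_co pw'x) // (pos_co (h a aP)).
have aD := sroot aP; have x0D : w'^-1%VF a \in D by apply: wroot.
have px0 : pos (w'^-1%VF a).
  apply: contraR na => npx0.
  have : inverts w (- w'^-1%VF a).
    apply: sub; rewrite /inverts (posNE rootD simpleP) // npx0 linearN /= w'K.
    exact/(posN rootD simpleP)/(pos_simple simpleP).
  by case/andP => _; rewrite linearN (posNE rootD simpleP) ?wroot // negbK.
have wx0 : inverts w (w'^-1%VF a) by rewrite /inverts px0.
have ga : 0 < ip (w' theta) a.
  rewrite -[a]w'K (wiso W') ipC -(gr_gt0 rootD highestT).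
  by case: (inv_gr Ww wx0) => ->; rewrite ?gr_theta.
exists a; split=> //; first by rewrite /inverts w'K (pos_simple simpleP aP) andbF.
by move=> y; rewrite step_inv // => /orP[/sub //|/eqP->].
Qed.

(** [weak_step] gives a weak-order chain from [w'] up to [w]; the number of roots inverted by [w]
    and not by [w'] drops at each step. *)
Lemma weak_ind w (Q : 'End(V) -> Prop) : W0 w -> Q w ->
  (forall w' a, W0 w' -> a \in P -> 0 < ip (w' theta) a -> inverts w (w'^-1%VF a) ->
     ~~ inverts w' (w'^-1%VF a) ->
     (forall y, inverts (refl a \o w')%VF y -> inverts w y) -> Q (refl a \o w')%VF -> Q w') ->
  forall w', W0 w' -> (forall y, inverts w' y -> inverts w y) -> Q w'.
Proof.
move=> Ww Qw step w'.
have [n] := ubnP #|` [fset x in D | inverts w x && ~~ inverts w' x]%fset|.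
elim: n w' => // n IH w' hn Ww' sub.
have [/hasP[x xD /andP[wx w'x]]|/hasPn h] :=
  boolP (has (fun x => inverts w x && ~~ inverts w' x) D); last first.
  rewrite (W0_inv_eq Ww' Ww) // => x; apply/idP/idP => [/sub //|wx].
  by have := h _ (pos_root (inv_pos wx)); rewrite wx negbK.
have [a [aP ga wx0 nx0 sub']] := weak_step Ww Ww' sub wx w'x.
apply: (step _ a) => //; apply: IH => //; last exact: step_W0.
rewrite ltnS in hn; apply: leq_trans hn; apply: fproper_ltn_card.
apply: (@fsub_proper_trans _ ([fset x in D | inverts w x && ~~ inverts w' x] `\ (w'^-1%VF a))%fset).
  apply/fsubsetP => y; rewrite !inE /= step_inv // negb_or.
  by case/and4P => -> -> -> ->.
apply: fproperD1; rewrite !inE /= wx0 nx0 (pos_root (inv_pos wx0)) //.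
Qed.

(** * Dominance order on long coroots against inclusion of inversion sets *)

Lemma coroot_refl a v : a != 0 ->
  coroot (refl a v) = coroot v - ip a (coroot v) *: coroot a.
Proof.
move=> a0; rewrite /Defs.coroot reflection_iso // reflectionE scalerBr !scalerA.
by congr (_ - _ *: _); rewrite !ipE (ipC ip a v); ring.
Qed.

Lemma coroot_weyl w v : weyl ip D w -> w (coroot v) = coroot (w v).
Proof. by move=> W; apply: coroot_iso; apply: wiso. Qed.

Lemma long_weyl w : weyl ip D w -> long ip D theta (w theta).
Proof. by move=> W; split; rewrite ?(wiso W) // wroot ?theta_root. Qed.

(** This makes the reflection in [a] move the coroot of [v] by exactly one copy of the coroot of
    [a]. *)
Lemma long_pairing1 a v : long ip D theta v -> a \in P -> v != a -> 0 < ip v a ->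
  ip a (coroot v) = 1.
Proof.
move=> vl aP va h; have [vD _] := vl; have aD := sroot aP; have v0 := neq0 vD.
have h1 : 0 < ip a (coroot v) by rewrite ip_coroot_gt0 // ipC.
have aNv : a != - v.
  by apply: contraTneq h => ->; rewrite ipNr oppr_gt0 -leNgt ltW // ip_gt0.
have := long_pairing rootD simpleP highestT vl aD _ aNv.
rewrite eq_sym va gtr0_norm // => /(_ isT) h2; apply/eqP; rewrite eq_le h2.
exact: int_gt0_ge1 (root_int rootD vD aD) h1.
Qed.

Lemma simple_coroot a : a \in P -> coroot a \in simple_coroots ip P.
Proof. by move=> aP; apply: in_imfset. Qed.

Lemma natcomb_coroots_co b x : natcomb (simple_coroots ip P) x -> b \in P -> 0 <= co b x.
Proof.
case=> c -> bP; rewrite linear_sum big_seq sumr_ge0 // => _ /imfsetP[a /= aP ->].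
rewrite -scaler_nat !linearZ /= (co_simple basis bP aP) mulr_ge0 ?ler0n // mulr_ge0 ?ler0n //.
by rewrite divr_ge0 ?ler0n // ltW // ip_gt0 // neq0 // sroot.
Qed.

Lemma le_simple_coroot a v : a \in P -> pos v -> le_coroot ip P (coroot v) (coroot a) ->
  v = a.
Proof.
move=> aP pv le; have vD := pos_root pv.
have vE : v = co a v *: a.
  rewrite {1}(coE basis v) (big_fsetD1 a) //= big_seq big1 ?addr0 // => b.
  rewrite in_fsetD1 => /andP[ba bP]; have := natcomb_coroots_co le bP.
  rewrite linearB !linearZ /= (co_simple basis bP aP) (negbTE ba) mulr0 sub0r oppr_ge0.
  rewrite pmulr_rle0 ?divr_gt0 ?ltr0n ?ip_gt0 ?neq0 // => h.
  by rewrite (_ : co b v = 0) ?scale0r //; apply/eqP; rewrite eq_le h (pos_co pv).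
have := vD; rewrite {1}vE => /(root_reduced rootD (sroot aP)) [] k1.
  by rewrite vE k1 scale1r.
by have := pos_co pv aP; rewrite k1 ler0N1.
Qed.

(** Each step up the weak order subtracts from the coroot of [w' theta] a nonnegative integer
    multiple of a simple coroot. *)
Lemma inv_le_coroot w w' : W0 w -> W0 w' -> (forall x, inverts w' x -> inverts w x) ->
  le_coroot ip P (coroot (w theta)) (coroot (w' theta)).
Proof.
move=> Ww Ww' sub; move: w' Ww' sub; apply: (weak_ind Ww).
  by rewrite /le_coroot subrr; apply: natcomb0.
move=> w' a Ww' aP ga _ _ _; rewrite /le_coroot comp_lfunE coroot_refl; last first.
  by rewrite neq0 // sroot.
rewrite addrAC => h; rewrite -[_ - _](subrK (ip a (coroot (w' theta)) *: coroot a)).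
have vD : w' theta \in D by apply: wroot (W0_weyl Ww') theta_root.
apply: natcombD => //; apply: natcombZ; last exact/natcomb_mem/simple_coroot.
rewrite natrEint (root_int rootD vD (sroot aP)) /=.
by rewrite ltW // ip_coroot_gt0 ?neq0 // ipC.
Qed.

(** Induction on the number of simple coroots in the difference: one that pairs positively with the
    difference is removed, by lowering the upper coroot or raising the lower one. Equality of signs
    excludes the jump between the coroots of [a] and [- a], which would move by two copies. *)
Lemma le_coroot_inv w w' : W0 w -> W0 w' -> pos (w theta) = pos (w' theta) ->
  le_coroot ip P (coroot (w theta)) (coroot (w' theta)) ->
  forall x, inverts w' x -> inverts w x.
Proof.
move=> Ww Ww' ps [c le].
have [n] : exists n, natcombn (simple_coroots ip P) n (coroot (w' theta) - coroot (w theta)).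
  by exists (\sum_(a <- simple_coroots ip P) c a)%N, c.
elim: n w w' Ww Ww' ps {c le} => [|n IH] w w' Ww Ww' ps le x.
all: have W := W0_weyl Ww; have W' := W0_weyl Ww'.
all: have vl := long_weyl W; have v'l := long_weyl W'.
all: have [vD _] := vl; have [v'D _] := v'l.
all: have [|ne] := eqVneq (coroot (w' theta) - coroot (w theta)) 0;
  [by move/eqP; rewrite subr_eq0 => /eqP /coroot_inj e; rewrite (W0_eq Ww Ww') // e ?neq0|].
(* For [n = 0] the conjunct [0 < n] is absurd, which closes that case. *)
all: have [_ [/imfsetP[a /= aP ->] ga //= _ le']] := natcombn_step ip le ne.
have aD := sroot aP; have a0 := neq0 aD.
have le2 : le_coroot ip P (coroot (w theta)) (coroot (w' theta)).
  by case: le => c e _; exists c.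
have [va|va] := ltP 0 (ip (w' theta) a).
  have v'a : w' theta != a.
    apply/eqP => e; have := ne; rewrite e (_ : w theta = a) ?subrr ?eqxx //.
    by apply: le_simple_coroot => //; rewrite -?e // ps e (pos_simple simpleP).
  have v'Na : w' theta != - a.
    by apply: contraTneq va => ->; rewrite ipNl oppr_gt0 -leNgt ltW // ip_gt0.
  have Ws := step_W0 Ww' aP va => xinv.
  apply: (IH _ (refl a \o w')%VF) => //; last by rewrite step_inv ?xinv.
    by rewrite comp_lfunE pos_reflE.
  rewrite comp_lfunE coroot_refl // (long_pairing1 v'l) // scale1r.
  by rewrite addrAC.
(* Now [(w' theta, a) <= 0], while [a] pairs positively with the difference; hence
   [(w theta, a) < 0], and [w] is replaced by [s_a w], one step below [w] in the weak order. *)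
have {}va : ip (w theta) a < 0.
  have h : 0 < ip (coroot (w' theta) - coroot (w theta)) a.
    by rewrite -(ip_coroot_gt0 ip _ a0).
  rewrite ltNge; apply/negP => va2; move: h; rewrite ltNge !ipE.
  rewrite subr_le0 (@le_trans _ _ 0) //; [rewrite mulr_ge0_le0|rewrite mulr_ge0] => //;
  by rewrite divr_ge0 ?ler0n // ltW // ip_gt0 // neq0.
have vNa : w theta != - a.
  apply/eqP => e; have := ne; rewrite (_ : w' theta = - a) ?e ?subrr ?eqxx //.
  rewrite -[LHS]opprK; congr (- _); apply: le_simple_coroot => //.
    by rewrite (posNE rootD simpleP) // -ps e (posN rootD simpleP) // (pos_simple simpleP).
  by move: le2; rewrite /le_coroot e !corootN !opprK addrC.
have va' : w theta != a.
  by apply: contraTneq va => ->; rewrite -leNgt ltW // ip_gt0.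
have Ws : W0 (refl a \o w)%VF by apply: W0_refl; rewrite // lt_eqF.
have gs : 0 < ip ((refl a \o w)%VF theta) a.
  by rewrite comp_lfunE -[a in ip _ a](reflectionK ip a0) reflection_iso // reflection_self // ipNr oppr_gt0.
have wE : w = (refl a \o (refl a \o w))%VF.
  by apply/lfunP => y; rewrite !comp_lfunE reflectionK.
move=> xinv; rewrite wE step_inv //; apply/orP; left.
apply: (IH _ w') => //; first by rewrite comp_lfunE pos_reflE.
have m1 : ip a (coroot (w theta)) = -1.
  apply/eqP; rewrite -eqr_oppLR -ipNr -corootN; apply/eqP.
  apply: long_pairing1 => //; first by split; rewrite ?(opp_root rootD) // ipNl ipNr opprK; case: vl.
    by rewrite eqr_oppLR.
  by rewrite ipNl oppr_gt0.
by rewrite comp_lfunE coroot_refl // m1 scaleN1r opprK opprD addrA.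
Qed.

(** * The gluing: inversions of grade 1 and the sign of [w theta] *)

Lemma theta_switch w : W0 w -> w theta \in P ->
  W0 (refl (w theta) \o w)%VF /\ forall x, gr x = 1 -> inverts (refl (w theta) \o w)%VF x = inverts w x.
Proof.
move=> Ww aP; have W := W0_weyl Ww.
have h : 0 < ip (w theta) (w theta) by rewrite ip_gt0 // neq0 // sroot.
split; first exact: step_W0.
(* The added inversion is the preimage of [w theta], that is [theta], which has grade 2. *)
move=> x x1; rewrite step_inv // (weyl_K rootD W).
have [e|_] := eqVneq; last by rewrite orbF.
by move/eqP: x1; rewrite e gr_theta -[2]/(2%:R) -[1]/(1%:R) eqr_nat.
Qed.

(** On a weak-order chain from [w'] to [w], some step adds the inversion [theta]; the element [w1]
    before that step sends [theta] to the simple root of the step. *)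
Lemma theta_crossing w w' : W0 w -> W0 w' -> (forall x, inverts w' x -> inverts w x) ->
  inverts w theta -> ~~ inverts w' theta ->
  exists w1, [/\ W0 w1, w1 theta \in P, forall x, inverts w' x -> inverts w1 x &
    forall x, inverts (refl (w1 theta) \o w1)%VF x -> inverts w x].
Proof.
move=> Ww Ww' sub wt; move: w' Ww' sub; apply: (weak_ind Ww); first by rewrite wt.
move=> w' a Ww' aP ga wx nx sub IH nt.
have [e|ne] := eqVneq (w'^-1%VF a) theta.
  have wE : w' theta = a by rewrite -e (weyl_VK rootD (W0_weyl Ww')).
  by exists w'; split=> //; rewrite wE.
case: IH => [|w1 [Ww1 w1P sub1 sub2]]; first by rewrite step_inv // negb_or nt eq_sym.
by exists w1; split=> // x hx; apply: sub1; rewrite step_inv // hx.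
Qed.

(** A long root climbs by simple reflections to [theta], the only dominant root of its length.
    Retracing the climb stays in [W^0] by [W0_refl]. *)
Lemma long_W0 v : long ip D theta v -> exists2 w, W0 w & w theta = v.
Proof.
case=> vD; move: v vD.
apply: (climb_ind rootD simpleP highestT) => v vD IH vl.
have [/allP hn|/allPn[a aP]] := boolP (all (fun a => 0 <= ip v a) P).
  have [_ /(_ vl) ->] := dominant_root rootD simpleP highestT vD hn.
  by exists \1%VF; [exact: W0_id | rewrite id_lfunE].
rewrite -ltNge => va; have aD := sroot aP; have a0 := neq0 aD.
have [|w Ww we] := IH a aP va; first by rewrite reflection_iso.
exists (refl a \o w)%VF; last by rewrite comp_lfunE we reflectionK.
apply: W0_refl => //; rewrite we -[a in ip _ a](reflectionK ip a0) reflection_iso //.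
by rewrite reflection_self // ipNr oppr_eq0 lt_eqF.
Qed.

Local Notation inverts1 w w' := (forall x, gr x = 1 -> inverts w x -> inverts w' x).

Lemma gr1_neq_theta x : gr x = 1 -> x != theta.
Proof.
by move/eqP; apply: contraTneq => ->; rewrite gr_theta -[2]/(2%:R) -[1]/(1%:R) eqr_nat.
Qed.

Lemma inv_theta w : W0 w -> inverts w theta = ~~ pos (w theta).
Proof. by move=> Ww; rewrite /inverts (theta_pos rootD simpleP highestT). Qed.

Lemma inv_extend w w' : W0 w -> W0 w' -> inverts1 w w' ->
  (inverts w theta -> inverts w' theta) -> forall x, inverts w x -> inverts w' x.
Proof. by move=> Ww Ww' h ht x wx; case: (inv_gr Ww wx) => [e|/h]; [rewrite e in wx *; apply: ht|apply]. Qed.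

(** [theta] is the only root inverted by [w'] and not by [w], so a single weak-order step,
    reflecting in [w theta], leads from [w] to [w']. *)
Lemma inv1_eq w w' : W0 w -> W0 w' -> (forall x, gr x = 1 -> inverts w x = inverts w' x) ->
  ~~ inverts w theta -> inverts w' theta ->
  w theta \in P /\ w' theta = - w theta.
Proof.
move=> Ww Ww' h nt ht.
have sub x : inverts w x -> inverts w' x.
  by apply: inv_extend => // y /h ->.
have [a [aP ga w'x wx sub2]] := weak_step Ww' Ww sub ht nt.
have xt : w^-1%VF a = theta.
  by case: (inv_gr Ww' w'x) => // /h e; rewrite e w'x in wx.
have wE : w theta = a by rewrite -xt (weyl_VK rootD (W0_weyl Ww)).
split; first by rewrite wE.
suff <- : (refl a \o w)%VF = w' by rewrite comp_lfunE wE reflection_self // neq0 // sroot.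
apply: W0_inv_eq => //; first exact: step_W0.
move=> x; apply/idP/idP => [/sub2 //|w'x']; rewrite step_inv // xt.
by case: (inv_gr Ww' w'x') => [->|/h ->]; rewrite ?eqxx ?orbT // w'x'.
Qed.

Lemma pos_add u v : pos u -> pos v -> u + v \in D -> pos (u + v).
Proof.
move=> pu pv uvD; rewrite /posroot uvD; apply/allP => a aP.
by rewrite linearD /= addr_ge0 ?(pos_co pu) ?(pos_co pv).
Qed.

Lemma gr1_sub x : x \in D -> gr x = 1 -> theta - x \in D /\ gr (theta - x) = 1.
Proof.
move=> xD x1; split; last by rewrite ipDl ipNl gr_theta x1; ring.
apply: (sub_root rootD) => //; first exact: theta_root.
  by rewrite ipC -(gr_gt0 rootD highestT) x1.
by rewrite eq_sym gr1_neq_theta.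
Qed.

Lemma neg_partP x : neg_part ip D P theta x <->
  exists v, [/\ long ip D theta v, ~~ pos v & x = coroot v].
Proof.
split=> [[_ [v [vl /(positiveP rootD simpleP) pv] <-] <-]|[v [vl nv ->]]].
  exists (- v); split; [|exact: (posN rootD simpleP pv)|by rewrite corootN].
  by case: vl => vD vl; split; rewrite ?(opp_root rootD) // ipNl ipNr opprK.
have [vD vn] := vl; exists (coroot (- v)); last by rewrite corootN opprK.
exists (- v) => //; split; first by split; rewrite ?(opp_root rootD) // ipNl ipNr opprK.
by apply/(positiveP rootD simpleP); rewrite (posNE rootD simpleP).
Qed.

Lemma pos_partP x : pos_part ip D P theta x <->
  exists v, [/\ long ip D theta v, pos v & x = coroot v].
Proof.
split=> [[v [vl /(positiveP rootD simpleP) pv] <-]|[v [vl pv ->]]]; first by exists v.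
by exists v => //; split=> //; apply/(positiveP rootD simpleP).
Qed.

Lemma long_coroot_inj u v : long ip D theta u -> long ip D theta v ->
  coroot u = coroot v -> u = v.
Proof. by move=> [uD _] [vD _]; apply: coroot_inj; apply: neq0. Qed.

Lemma long_opp v : long ip D theta v -> long ip D theta (- v).
Proof. by case=> vD vl; split; rewrite ?(opp_root rootD) // ipNl ipNr opprK. Qed.

(** Lifts any member of a class to [W^0] without changing the inversions of grade 1: a second member
    of the class comes from reflecting in the glued simple root, which affects [theta] only. *)
Lemma glue_class_W0 w y : W0 w -> glue_class ip D P theta (coroot (w theta)) y ->
  exists w1, [/\ W0 w1, y = coroot (w1 theta) & forall x, gr x = 1 -> inverts w1 x = inverts w x].
Proof.
move=> Ww; have vl := long_weyl (W0_weyl Ww).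
case=> _ [<-|[a [aP al] [[e ->]|[e ->]]]]; first by exists w.
  have wE : w theta = a by apply: long_coroot_inj e; rewrite // /long /=; split=> //; exact: sroot.
  have [|Ww' h] := theta_switch Ww; first by rewrite wE.
  exists (refl (w theta) \o w)%VF; split=> //.
  by rewrite comp_lfunE reflection_self ?corootN wE // neq0 // sroot.
have aD := sroot aP; have a0 := neq0 aD.
have wE : w theta = - a.
  by apply: long_coroot_inj; rewrite ?corootN //; apply: long_opp.
have Ww1 : W0 (refl a \o w)%VF.
  by apply: W0_refl => //; rewrite wE ipNl oppr_eq0 gt_eqF // ip_gt0.
have w1E : (refl a \o w)%VF theta = a.
  by rewrite comp_lfunE wE linearN /= reflection_self // opprK.
exists (refl a \o w)%VF; split=> //; first by rewrite w1E.
have := theta_switch Ww1; rewrite w1E => -[] // _ h x x1.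
rewrite -h //; congr (inverts _ x); apply/lfunP => y'.
by rewrite !comp_lfunE reflectionK.
Qed.

Lemma glue_class_refl w : W0 w -> glue_class ip D P theta (coroot (w theta)) (coroot (w theta)).
Proof.
by move=> Ww; split; [exists (w theta) => //; exact: long_weyl (W0_weyl Ww)|left].
Qed.

Lemma glued_sym x y : glued ip P theta x y -> glued ip P theta y x.
Proof.
by case=> [->|[a al [[-> ->]|[-> ->]]]]; [left|right; exists a => //; right|right; exists a => //; left].
Qed.

Lemma inv1_glued w w' : W0 w -> W0 w' -> (forall x, gr x = 1 -> inverts w x = inverts w' x) ->
  glued ip P theta (coroot (w theta)) (coroot (w' theta)).
Proof.
move=> Ww Ww' h.
have key w1 w2 : W0 w1 -> W0 w2 -> (forall x, gr x = 1 -> inverts w1 x = inverts w2 x) ->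
    ~~ inverts w1 theta -> inverts w2 theta ->
    glued ip P theta (coroot (w1 theta)) (coroot (w2 theta)).
  move=> W1 W2 h12 n1 i2; have [aP e] := inv1_eq W1 W2 h12 n1 i2.
  right; exists (w1 theta); last by left; rewrite e corootN.
  by split=> //; case: (long_weyl (W0_weyl W1)).
have [i|n] := boolP (inverts w theta); have [i'|n'] := boolP (inverts w' theta).
- left; suff -> : w = w' by []; apply: W0_inv_eq => // x.
  by apply/idP/idP; apply: inv_extend => // y y1; rewrite h.
- by apply/glued_sym/key => // x x1; rewrite h.
- exact: key.
left; suff -> : w = w' by []; apply: W0_inv_eq => // x.
by apply/idP/idP; apply: inv_extend; rewrite ?(negbTE n) ?(negbTE n') // => y y1; rewrite h.
Qed.

Lemma glue_class_eq w w' : W0 w -> W0 w' -> (forall x, gr x = 1 -> inverts w x = inverts w' x) ->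
  glue_class ip D P theta (coroot (w theta)) = glue_class ip D P theta (coroot (w' theta)).
Proof.
move=> Ww Ww' h.
have key w1 w2 : W0 w1 -> W0 w2 -> (forall x, gr x = 1 -> inverts w1 x = inverts w2 x) ->
    (glue_class ip D P theta (coroot (w1 theta)) `<=` glue_class ip D P theta (coroot (w2 theta)))%classic.
  move=> W1 W2 h12 y hy; have [w3 [W3 -> h3]] := glue_class_W0 W1 hy.
  split; first by exists (w3 theta) => //; exact: long_weyl (W0_weyl W3).
  by apply: inv1_glued => // x x1; rewrite h3 // h12.
by apply/seteqP; split; apply: key => // x x1; rewrite h.
Qed.

(** For equal signs of [w theta] and [w' theta] this is the agreement of dominance and weak order. A
    negative one below a positive one is joined through a simple root; a positive one below a
    negative one forces equal classes. *)
Lemma inv1_le_quotient w w' : W0 w -> W0 w' ->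
  inverts1 w' w <-> le_quotient ip D P theta (glue_class ip D P theta (coroot (w theta)))
    (glue_class ip D P theta (coroot (w' theta))).
Proof.
move=> Ww Ww'; have W := W0_weyl Ww; have W' := W0_weyl Ww'.
have vl := long_weyl W; have v'l := long_weyl W'.
split=> [sub|].
  have [p|n] := boolP (pos (w theta)); have [p'|n'] := boolP (pos (w' theta)).
  - constructor 1; exists (coroot (w theta)), (coroot (w' theta)).
    split; [exact: glue_class_refl|exact: glue_class_refl| | |].
    + by apply/pos_partP; exists (w theta).
    + by apply/pos_partP; exists (w' theta).
    by apply: inv_le_coroot => //; apply: inv_extend => //; rewrite inv_theta // p'.
  (* If [w x] is negative then [w (theta - x)] is positive, so [theta - x] is inverted neither by
     [w] nor by [w']. As [w' theta] is negative, [w' x] must be negative. *)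
  - have eqL x : gr x = 1 -> inverts w x = inverts w' x.
      move=> x1; apply/idP/idP => [wx|]; last exact: sub.
      have xD := pos_root (inv_pos wx); have [yD y1] := gr1_sub xD x1.
      have pwy : pos (w (theta - x)).
        rewrite linearB /=; apply: pos_add => //; last by rewrite -linearB wroot.
        by rewrite (posNE rootD simpleP) ?wroot //; case/andP: wx.
      have pw'y : pos (w' (theta - x)).
        apply: contraT => npy; have := sub _ y1.
        by rewrite /inverts npy pwy gr_pos ?y1 // => /(_ isT).
      rewrite /inverts gr_pos ?x1 //=; apply: contra n' => pw'x.
      have -> : w' theta = w' x + w' (theta - x) by rewrite -linearD addrC subrK.
      by apply: pos_add => //; rewrite -linearD wroot // addrC subrK theta_root.
    constructor 1; exists (coroot (w theta)), (coroot (w theta)).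
    split; rewrite ?(glue_class_eq Ww Ww' eqL); try by rewrite -(glue_class_eq Ww Ww' eqL); exact: glue_class_refl.
    + by apply/pos_partP; exists (w theta).
    + by apply/pos_partP; exists (w theta).
    by rewrite /le_coroot subrr; apply: natcomb0.
  - have ht : inverts w theta by rewrite inv_theta.
    have nt : ~~ inverts w' theta by rewrite inv_theta // p'.
    have sub' : forall x, inverts w' x -> inverts w x by apply: inv_extend.
    (* The simple root through which the two parts are joined is [w1 theta], where the chain
       acquires the inversion [theta]. *)
    have [w1 [W1 aP sub1 sub2]] := theta_crossing Ww Ww' sub' ht nt.
    constructor 3; exists (coroot (w theta)), (coroot (w' theta)).
    split; [exact: glue_class_refl|exact: glue_class_refl| | |].
    + by apply/neg_partP; exists (w theta).
    + by apply/pos_partP; exists (w' theta).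
    exists (w1 theta); first by split=> //; case: (long_weyl (W0_weyl W1)).
    split; last exact: inv_le_coroot.
    rewrite -corootN -(reflection_self ip (neq0 (sroot aP))) -comp_lfunE.
    by apply: inv_le_coroot => //; case: (theta_switch W1 aP).
  constructor 2; exists (coroot (w theta)), (coroot (w' theta)).
  split; [exact: glue_class_refl|exact: glue_class_refl| | |].
  + by apply/neg_partP; exists (w theta).
  + by apply/neg_partP; exists (w' theta).
  by apply: inv_le_coroot => //; apply: inv_extend => //; rewrite !inv_theta.
case=> -[_ [_ [/(glue_class_W0 Ww)[w1 [W1 -> h1]] /(glue_class_W0 Ww')[w2 [W2 -> h2]]]]].
- move=> /pos_partP[u [ul pu /(long_coroot_inj (long_weyl (W0_weyl W1)) ul) e1]].
  move=> /pos_partP[u' [ul' pu' /(long_coroot_inj (long_weyl (W0_weyl W2)) ul') e2]].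
  move=> le x x1; rewrite -h1 // -h2 //; apply: le_coroot_inv => //.
  by rewrite e1 e2 pu pu'.
- move=> /neg_partP[u [ul pu /(long_coroot_inj (long_weyl (W0_weyl W1)) ul) e1]].
  move=> /neg_partP[u' [ul' pu' /(long_coroot_inj (long_weyl (W0_weyl W2)) ul') e2]].
  move=> le x x1; rewrite -h1 // -h2 //; apply: le_coroot_inv => //.
  by rewrite e1 e2 (negbTE pu) (negbTE pu').
move=> /neg_partP[u [ul pu /(long_coroot_inj (long_weyl (W0_weyl W1)) ul) e1]].
move=> /pos_partP[u' [ul' pu' /(long_coroot_inj (long_weyl (W0_weyl W2)) ul') e2]].
move=> [a [aP al] [le1 le2]] x x1; rewrite -h1 // -h2 // => w2x.
(* The glued pair is realised by [w3] and its switch, which have the same inversions of grade 1, so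
   the inclusions from the two sides compose. *)
have [w3 W3 w3a] := long_W0 (conj (sroot aP) al : long ip D theta a).
have w3P : w3 theta \in P by rewrite w3a.
have [W4 h4] := theta_switch W3 w3P.
have a0 := neq0 (sroot aP).
have w4a : (refl (w3 theta) \o w3)%VF theta = - a by rewrite comp_lfunE w3a reflection_self.
apply: (le_coroot_inv W1 W4); rewrite ?w4a ?corootN //.
  by rewrite e1 (negbTE pu); apply/esym/negbTE/(posN rootD simpleP)/(pos_simple simpleP).
rewrite h4 //; apply: (le_coroot_inv W3 W2) w2x; rewrite ?w3a //.
by rewrite e2 pu'; apply: (pos_simple simpleP).
Qed.

(** * Lower ideals of Delta(1) as inversion sets *)

Local Notation le1 := (le1 ip P theta).

(** Simple roots have nonnegative grade, so those of positive grade cannot occur in a sum of grade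
    0. *)
Lemma pos_simple0 x : pos x -> gr x = 0 -> natcomb (simple0 ip P theta) x.
Proof.
move=> px x0; have [c cE] := pos_natcomb rootD simpleP px; exists c.
have term0 a : a \in P -> (c a)%:R * gr a = 0 :> R.
  have ge0 b : b \in P -> 0 <= (c b)%:R * gr b.
    by move=> bP; rewrite mulr_ge0 ?ler0n // pos_gr // (pos_simple simpleP).
  move=> aP; apply/eqP; rewrite eq_le ge0 // andbT -[X in _ <= X]x0 cE ip_suml.
  rewrite (big_fsetD1 a) //= -scaler_nat ipZl lerDl big_seq sumr_ge0 // => b.
  by rewrite in_fsetD1 => /andP[_ bP]; rewrite -scaler_nat ipZl ge0.
rewrite {1}cE; apply/esym/big_fset_incl; first by apply/fsubsetP => a; rewrite !inE => /andP[].
move=> a aP; rewrite !inE /= aP /= => a0.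
by have /eqP := term0 a aP; rewrite mulf_eq0 (negbTE a0) orbF pnatr_eq0 => /eqP->.
Qed.

(** [w] keeps the simple roots of grade 0 positive, so [w y] is [w x] plus a vector with nonnegative
    coordinates. *)
Lemma le1_inv w x y : W0 w -> x \in D -> gr x = 1 -> le1 x y -> inverts w y -> inverts w x.
Proof.
move=> Ww xD x1 [c cE] wy; rewrite /inverts gr_pos ?x1 //=.
case/andP: wy => py; apply: contra => pwx; have W := W0_weyl Ww.
rewrite /posroot wroot ?(pos_root py) //=; apply/allP => b bP.
rewrite -(subrK x y) cE !linearD /= addr_ge0 ?(pos_co pwx) // !linear_sum /=.
rewrite big_seq sumr_ge0 // => a; rewrite !inE /= => /andP[aP /eqP a0].
have pwa : pos (w a) by rewrite (W0_pos Ww) ?(pos_simple simpleP) ?sroot.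
by rewrite -scaler_nat !linearZ /= mulr_ge0 ?ler0n // (pos_co pwa).
Qed.

(** [(x, y)] and [(theta - x, y)] add up to [(theta, y) > 0], so one is positive; two roots of grade
    1 with positive product are equal or differ by a root of grade 0. *)
Lemma theta_pairing x y : x \in D -> y \in D -> gr x = 1 -> gr y = 1 ->
  [\/ le1 x y, le1 y x, le1 (theta - x) y | le1 y (theta - x)].
Proof.
have key u v : u \in D -> v \in D -> gr u = 1 -> gr v = 1 -> 0 < ip u v ->
    le1 u v \/ le1 v u.
  move=> uD vD u1 v1 uv; have [->|ne] := eqVneq u v.
    by left; rewrite /Defs.le1 subrr; apply: natcomb0.
  have dD := sub_root rootD uD vD uv ne.
  have d0 : gr (u - v) = 0 by rewrite ipDl ipNl u1 v1 subrr.
  case/orP: (pos_or rootD simpleP dD) => [p|]; first by right; apply: pos_simple0.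
  rewrite opprB => p; left; apply: pos_simple0 => //.
  by rewrite -opprB ipNl d0 oppr0.
move=> xD yD x1 y1; have [tD t1] := gr1_sub xD x1.
have [xy|xy] := ltP 0 (ip x y).
  by case: (key x y) => // h; [constructor 1|constructor 2].
have ty : 0 < ip (theta - x) y.
  have : 0 < ip y theta by rewrite -(gr_gt0 rootD highestT) y1.
  by rewrite ipDl ipNl (ipC ip y) => h; rewrite ltr_wpDr // oppr_ge0.
by case: (key (theta - x) y) => // h; [constructor 3|constructor 4].
Qed.

(** The signs that [w] should produce are prescribed on all roots, and [weyl_positive_system]
    supplies [w] once the zero-sum condition is checked grade by grade. *)
Lemma ideal_W0 (L : pred V) :
    (forall x y, x \in D -> y \in D -> gr x = 1 -> gr y = 1 -> le1 x y -> L y -> L x) ->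
  exists2 w, W0 w & forall x, x \in D -> gr x = 1 -> inverts w x = L x.
Proof.
move=> lowL.
(* [b] decides whether [theta] is inverted. If [L] contains some pair [x, theta - x], it meets every
   such pair by [theta_pairing], since [theta - _] reverses the order; otherwise it contains
   none. *)
have [b bL] : exists b : bool, forall x, x \in D -> gr x = 1 ->
    if b then L x || L (theta - x) else ~~ (L x && L (theta - x)).
  have [/hasP[x xD /and3P[/eqP x1 Lx Lx']]|/hasPn h] :=
    boolP (has (fun x => [&& gr x == 1, L x & L (theta - x)]) D).
    exists true => y yD y1; have [x'D x'1] := gr1_sub xD x1.
    have [y'D y'1] := gr1_sub yD y1.
    have flip u v : le1 u v -> le1 (theta - v) (theta - u).
      by rewrite /Defs.le1 => h; rewrite opprB [_ - u + _]addrC addrA subrK.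
    case: (theta_pairing xD yD x1 y1) => [/flip|/lowL->//|/flip|/lowL->//].
      by move/lowL => ->; rewrite ?orbT.
    by rewrite subKr => /lowL->; rewrite ?orbT.
  exists false => x xD x1; have := h x xD; by rewrite x1 eqxx.
(* [C] is meant to be the set of roots that [w] makes positive. *)
pose C x := if gr x == 0 then pos x else if gr x == 1 then ~~ L x else
  if gr x == -1 then L (- x) else if x == theta then ~~ b else b.
have n1 : (1 == -1 :> R) = false by apply/eqP => e; lra.
have g0 x : gr x = 0 -> C x = pos x by rewrite /C => ->; rewrite eqxx.
have g1 x : gr x = 1 -> C x = ~~ L x by rewrite /C => ->; rewrite oner_eq0 eqxx.
have gN1 x : gr x = -1 -> C x = L (- x).
  by rewrite /C => ->; rewrite oppr_eq0 oner_eq0 eq_sym n1 eqxx.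
have g2 : gr theta == 0 = false /\ gr theta == 1 = false /\ gr theta == -1 = false.
  by rewrite gr_theta; split; [|split]; apply/eqP; lra.
have gt : C theta = ~~ b by rewrite /C; case: g2 => -> [-> ->]; rewrite eqxx.
have gNt : C (- theta) = b.
  rewrite /C ipNl gr_theta (_ : _ == theta = false); last first.
    by apply/eqP => e; have := gr_theta; rewrite -{1}e ipNl gr_theta; lra.
  by do 3![case: eqP => [?|_]; first by lra].
have CN x : x \in D -> C (- x) = ~~ C x.
  move=> xD; case: (grP xD) => [->|->|[h|h|h]]; rewrite ?opprK ?gt ?gNt ?negbK //.
  - by rewrite (g1 x) // gN1 ?ipNl ?h // opprK negbK.
  - by rewrite (g0 x) // g0 ?ipNl ?h ?oppr0 // (posNE rootD simpleP).
  by rewrite (gN1 x) // g1 ?ipNl ?h // opprK.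
(* The grades of three roots with sum 0 are, up to order, (0,0,0), (0,1,-1), (0,2,-2), (1,1,-2) or
   (-1,-1,2). [K1] rests on [L] being a lower ideal, [K3] and [K4] on the choice of [b]. *)
have K0 x y z : x + y + z = 0 -> gr x = 0 -> gr y = 0 -> gr z = 0 ->
    x \in D -> y \in D -> z \in D -> C x -> C y -> C z -> False.
  move=> s x0 y0 z0 xD yD zD; rewrite !g0 // => px py pz.
  have zE : x + y = - z by apply/eqP; rewrite -addr_eq0 s.
  have : pos (- z) by rewrite -zE pos_add // zE (opp_root rootD).
  by rewrite (posNE rootD simpleP) // pz.
have K1 x y z : x + y + z = 0 -> gr x = 0 -> gr y = 1 -> gr z = -1 ->
    x \in D -> y \in D -> z \in D -> C x -> C y -> C z -> False.
  move=> s x0 y1 zN1 xD yD zD; rewrite g0 // g1 // gN1 // => px /negP nLy Lz.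
  have zE : - z = x + y by apply/eqP; rewrite eq_sym -addr_eq0 s.
  apply/nLy/(lowL y (- z)) => //; rewrite ?(opp_root rootD) // ?ipNl ?zN1 ?opprK //.
  by rewrite /Defs.le1 zE addrK; apply: pos_simple0.
have K2 x y z : x + y + z = 0 -> gr x = 0 -> y = theta -> z = - theta ->
    x \in D -> y \in D -> z \in D -> C x -> C y -> C z -> False.
  move=> s _ yt zt xD; move: s; rewrite yt zt addrK => x0.
  by have := neq0 xD; rewrite x0 eqxx.
have K3 x y z : x + y + z = 0 -> gr x = 1 -> gr y = 1 -> z = - theta ->
    x \in D -> y \in D -> z \in D -> C x -> C y -> C z -> False.
  move=> s x1 y1 zt xD yD zD; rewrite zt g1 // g1 // gNt => /negP nLx /negP nLy bt.
  have yE : y = theta - x by move/eqP: s; rewrite zt subr_eq0 => /eqP <-; rewrite addrC addKr.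
  by have := bL x xD x1; rewrite bt -yE => /orP[].
have K4 x y z : x + y + z = 0 -> gr x = -1 -> gr y = -1 -> z = theta ->
    x \in D -> y \in D -> z \in D -> C x -> C y -> C z -> False.
  move=> s xN1 yN1 zt xD yD zD; rewrite zt gN1 // gN1 // gt => Lx Ly /negbTE bf.
  have yE : - y = theta - - x.
    by rewrite opprK; apply/eqP; rewrite eq_sym -addr_eq0 addrAC addrC addrA addrAC -zt s.
  have := bL (- x); rewrite (opp_root rootD) ipNl xN1 opprK bf -yE Lx Ly /=.
  by move/(_ xD erefl).
have [|w W wE] := weyl_positive_system rootD simpleP CN.
  move=> x y z [xD yD zD] [Cx Cy Cz]; apply/eqP => s1.
  have s2 : x + z + y = 0 by rewrite addrAC.
  have s3 : y + x + z = 0 by rewrite (addrC y).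
  have s4 : y + z + x = 0 by rewrite addrAC.
  have s5 : z + x + y = 0 by rewrite (addrC z).
  have s6 : z + y + x = 0 by rewrite addrAC.
  have : gr x + gr y + gr z = 0 by rewrite -!ipDl s1 -(scale0r 0) ipZl mul0r.
  (* [Negz n] stands for [-(n+1)], so [Negz 1] is the grade -2 and [Negz 0] the grade -1. *)
  have gd u : u \in D -> exists2 n : int, gr u = n%:~R &
      match n with
      | Posz 2 => u = theta | Negz 1 => u = - theta
      | Posz 1 | Posz 0 | Negz 0 => True | _ => False
      end.
    case/grP => [->|->|[h|h|h]]; rewrite ?ipNl ?gr_theta ?h.
    - by exists 2.
    - by exists (-2).
    - by exists 1.
    - by exists 0.
    by exists (-1).
  have [nx hx tx] := gd _ xD; have [ny hy ty] := gd _ yD; have [nz hz tz] := gd _ zD.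
  rewrite hx hy hz -!intrD => /eqP; rewrite intr_eq0 => h.
  (* [K3] and [K4] are symmetric in [x] and [y], so for them only the place of [z] has to be
     tried. *)
  case: nx hx tx h => [[|[|[|?]]]|[|[|?]]] // hx tx; case: ny hy ty => [[|[|[|?]]]|[|[|?]]] // hy ty;
  case: nz hz tz => [[|[|[|?]]]|[|[|?]]] // hz tz _;
  first [ exact: (K0 _ _ _ s1) | exact: (K1 _ _ _ s1) | exact: (K1 _ _ _ s2) | exact: (K1 _ _ _ s3)
    | exact: (K1 _ _ _ s4) | exact: (K1 _ _ _ s5) | exact: (K1 _ _ _ s6)
    | exact: (K2 _ _ _ s1) | exact: (K2 _ _ _ s2) | exact: (K2 _ _ _ s3)
    | exact: (K2 _ _ _ s4) | exact: (K2 _ _ _ s5) | exact: (K2 _ _ _ s6)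
    | exact: (K3 _ _ _ s1) | exact: (K3 _ _ _ s2) | exact: (K3 _ _ _ s4)
    | exact: (K4 _ _ _ s1) | exact: (K4 _ _ _ s2) | exact: (K4 _ _ _ s4) ].
exists w; first by apply/W0P; split=> // x x0 px; rewrite -wE ?(pos_root px) // g0.
by move=> x xD x1; rewrite /inverts gr_pos ?x1 //= -wE // g1 // negbK.
Qed.

(** * Antichains of Delta(1) and the elements of [W^0] representing them *)

Local Notation grade1 := (grade ip D theta 1).
Local Notation minimals := (minimals ip P theta).
Local Notation ideal := (upper_ideal ip D P theta).
Local Notation coideal w := (grade1 `\` inversions D P w).

Lemma inversionsP w x : weyl ip D w -> x \in D -> inversions D P w x <-> inverts w x.
Proof.
move=> W xD; rewrite /inverts; split=> [[/(positiveP rootD simpleP) -> /(positiveP rootD simpleP)]|].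
  by rewrite (posNE rootD simpleP) // wroot.
case/andP => px nx; split; apply/(positiveP rootD simpleP) => //.
by rewrite (posNE rootD simpleP) // wroot.
Qed.

Lemma coidealP w x : W0 w -> coideal w x <-> grade1 x /\ ~~ inverts w x.
Proof.
move=> Ww; split=> -[gx h]; split=> //; first by apply/negP => /(inversionsP (W0_weyl Ww) gx.1).
by move/(inversionsP (W0_weyl Ww) gx.1); apply/negP.
Qed.

Lemma le1_ht x y : le1 x y -> x != y -> ht x <= ht y - 1.
Proof.
move=> [c cE] xy; have nz : y - x != 0 by rewrite subr_eq0 eq_sym.
have [|_ [_ _ c0 _]] := @natcombn_step _ _ ip (simple0 ip P theta) (\sum_(a <- simple0 ip P theta) c a)%N _ _ nz.
  by exists c.
rewrite lerBrDr -lerBrDl -linearB /= cE linear_sum /=.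
have -> : \sum_(a <- simple0 ip P theta) ht (a *+ c a) =
    \sum_(a <- simple0 ip P theta) (c a)%:R.
  rewrite big_seq [RHS]big_seq; apply: eq_bigr => a; rewrite !inE /= => /andP[aP _].
  by rewrite -scaler_nat linearZ /= (ht_simple basis aP) mulr1.
by rewrite -natr_sum ler1n.
Qed.

Lemma le1_refl x : le1 x x.
Proof. by rewrite /Defs.le1 subrr; apply: natcomb0. Qed.

Lemma le1_trans x y z : le1 x y -> le1 y z -> le1 x z.
Proof. by move=> xy yz; rewrite /Defs.le1 -(subrK y z) -addrA; apply: natcombD. Qed.

Lemma le1_anti x y : le1 x y -> le1 y x -> x = y.
Proof.
move=> xy yx; apply/eqP/contraT => ne; have := le1_ht xy ne.
by have := le1_ht yx; rewrite eq_sym => /(_ ne); lra.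
Qed.

Lemma exists_minimal (A : set V) x : A `<=` grade1 -> A x ->
  exists2 m, minimals A m & le1 m x.
Proof.
move=> sA Ax; have [xD x1] := sA x Ax.
have px : pos x by rewrite gr_pos // x1.
move: x px Ax {xD x1}; apply: (@pos_ind _ _ D P) => x px IH Ax.
have [[y [Ay yx yne]]|h] := pselect (exists y, [/\ A y, le1 y x & y != x]).
  have [yD y1] := sA y Ay.
  have [||//|m mA my] := IH y; first by rewrite gr_pos // y1.
    exact: le1_ht.
  by exists m => //; apply: le1_trans yx.
exists x; last exact: le1_refl.
by split=> // y Ay yx; apply/eqP/contraT => ne; case: h; exists y.
Qed.

Lemma minimals_ideal G : antichains ip D P theta G -> minimals (ideal G) = G.
Proof.
move=> [sG aG]; have GI g : G g -> ideal G g.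
  by move=> Gg; split; [exact: sG|exists g => //; exact: le1_refl].
apply/seteqP; split=> [x [[x1 [g Gg gx]] min]|g Gg]; first by rewrite -(min g) //; apply: GI.
split=> [|y [_ [g' Gg' g'y]] yg]; first exact: GI.
have e : g' = g by apply: aG => //; apply: le1_trans yg.
by apply: le1_anti => //; rewrite -e.
Qed.

(** By [le1_inv] the roots of grade 1 that [w] does not invert form an upper set, and by
    [exists_minimal] its minimal elements generate it. *)
Lemma represents_ideal G w : represents ip D P theta G w ->
  W0 w /\ forall x, grade1 x -> ideal G x <-> ~~ inverts w x.
Proof.
case=> Ww GE; split=> // x gx; split=> [[_ [g Gg gx']]|nx].
  move: Gg; rewrite -GE => -[/(coidealP _ Ww)[gg ng] _]; apply: contra ng.
  by apply: le1_inv gx'; rewrite // ?gg.1 //; case: gg.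
have [||m mG mx] := @exists_minimal (coideal w) x; [by move=> y []|exact/coidealP|].
by split=> //; exists m => //; rewrite -GE.
Qed.

Lemma antichain_represented G : antichains ip D P theta G ->
  exists w, represents ip D P theta G w.
Proof.
(* The lower ideal to be inverted is the complement of the upper ideal of [G]. *)
move=> aG; have [|w Ww wE] := @ideal_W0 (fun x => ~~ `[< ideal G x >]).
  move=> x y xD yD x1 y1 xy; apply: contra => /asboolP[gx [g Gg gx']].
  by apply/asboolP; split; [split|exists g => //; apply: le1_trans xy].
exists w; split=> //; rewrite -[RHS]minimals_ideal //; congr (minimals _).
apply/seteqP; split=> [x /(coidealP _ Ww)[[xD x1]]|x Ix].
  by rewrite wE // negbK => /asboolP.
have [xD x1] := Ix.1; apply/(coidealP _ Ww); split=> //; rewrite wE // negbK.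
exact/asboolP.
Qed.

Lemma minimals_represents w : W0 w ->
  antichains ip D P theta (minimals (coideal w)) /\
  represents ip D P theta (minimals (coideal w)) w.
Proof.
move=> Ww; split; last by split.
by split=> [x [[]]|x y [Ax _] [Ay minY]] //; apply: minY.
Qed.

(** Upper ideals and inversion sets of grade 1 are complementary, so inclusion is reversed. *)
Lemma represents_le_up G G' w w' :
  represents ip D P theta G w -> represents ip D P theta G' w' ->
  le_up ip D P theta G G' <-> inverts1 w' w.
Proof.
move=> /represents_ideal[Ww h] /represents_ideal[Ww' h']; split=> [le x x1 w'x|le x Ix].
  have gx : grade1 x by split; [exact: pos_root (inv_pos w'x)|].
  apply: contraT => /(h x gx) /le /(h' x gx); by rewrite w'x.
have gx := Ix.1; apply/(h' x gx); move/(h x gx): Ix; apply: contra.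
by apply: le; case: gx.
Qed.

Lemma represents_inv1 G w w' :
  represents ip D P theta G w -> represents ip D P theta G w' ->
  forall x, gr x = 1 -> inverts w x = inverts w' x.
Proof.
move=> Gw Gw' x x1; have le : le_up ip D P theta G G by [].
by apply/idP/idP; [move/(represents_le_up Gw' Gw): le|move/(represents_le_up Gw Gw'): le]; apply.
Qed.

Lemma le_up_anti G G' : antichains ip D P theta G -> antichains ip D P theta G' ->
  le_up ip D P theta G G' -> le_up ip D P theta G' G -> G = G'.
Proof.
move=> aG aG' h h'; rewrite -(minimals_ideal aG) -(minimals_ideal aG').
by congr (minimals _); apply/seteqP; split.
Qed.

End MinimalRepresentatives.

Theorem theorem4p12 (R : realType) (V : vectType R) (ip : {dot V for idfun})
    (D P : {fset V}) (theta : V) (rootD : root_system ip D)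
    (irrD : irreducible ip D)
    (simpleP : simple_roots D P) (highestT : highest_root D P theta) :
  exists F : set V -> set V,
    [/\ forall G, antichains ip D P theta G -> exists w, represents ip D P theta G w,
        forall G w, antichains ip D P theta G -> represents ip D P theta G w ->
          F G = glue_class ip D P theta (w (coroot ip theta)),
        set_bij (antichains ip D P theta) (glue_quotient ip D P theta) F &
        forall G G', antichains ip D P theta G -> antichains ip D P theta G' ->
          (le_up ip D P theta G G' <-> le_quotient ip D P theta (F G) (F G'))].
Proof.
have ex := antichain_represented rootD simpleP highestT.
(* [xget] picks some representing element; the default [\1] is reached only when [G] has none, which
   [ex] excludes for antichains. *)
pose F G := glue_class ip D P theta (xget \1%VF (represents ip D P theta G) (coroot ip theta)).
have FE G w : represents ip D P theta G w ->
    F G = glue_class ip D P theta (coroot ip (w theta)).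
  move=> Gw; rewrite /F; case: xgetP => [w' _ Gw'|/(_ w)//].
  rewrite (coroot_weyl rootD _ (W0_weyl Gw'.1)).
  exact: glue_class_eq Gw'.1 Gw.1 (represents_inv1 rootD simpleP highestT Gw' Gw).
have Fle G G' : antichains ip D P theta G -> antichains ip D P theta G' ->
    (le_up ip D P theta G G' <-> le_quotient ip D P theta (F G) (F G')).
  move=> /ex[w Gw] /ex[w' Gw']; rewrite (FE _ _ Gw) (FE _ _ Gw').
  rewrite (represents_le_up rootD simpleP highestT Gw Gw').
  exact: inv1_le_quotient Gw.1 Gw'.1.
exists F; split=> //.
  by move=> G w aG Gw; rewrite (FE _ _ Gw) (coroot_weyl rootD _ (W0_weyl Gw.1)).
split.
- move=> G /ex[w Gw]; rewrite (FE _ _ Gw); exists (coroot ip (w theta)) => //.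
  by exists (w theta) => //; apply: (long_weyl rootD highestT (W0_weyl Gw.1)).
(* Injectivity comes from the order: equal images are related both ways by reflexivity, and [le_up]
   is antisymmetric on antichains. *)
- move=> G G' /set_mem aG /set_mem aG' eFG.
  have lerefl H : antichains ip D P theta H -> le_quotient ip D P theta (F H) (F H).
    by move=> aH; apply/Fle.
  apply: (le_up_anti simpleP aG aG'); apply/Fle => //; first by rewrite -eFG; apply: lerefl.
  by rewrite eFG; apply: lerefl.
move=> _ [_ [v vl <-] <-].
have [w Ww <-] := long_W0 rootD simpleP highestT vl.
have [aG Gw] := minimals_represents Ww.
by exists (minimals ip P theta (grade ip D theta 1 `\` inversions D P w)); rewrite ?(FE _ _ Gw).
Qed.
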